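(* For a blocking scheme with $m$ block levels, there is a dynamic-programming algorithm that solves the problem $\mathrm{DOPT}(\mathcal{L})$ exactly (returns a prefix tree $T$ with $\mathrm{len}(T)\le\mathcal{L}$ of minimum decode time $\Delta(T)$, or reports that none exists) in time $O(n^{3+m})$, where $n$ is the alphabet size.
   Context: Let $C$ be an alphabet of $n$ characters, each $c\in C$ with a nonnegative frequency $\mathrm{freq}(c)$. A prefix tree for $C$ is a rooted binary tree in which every internal node has exactly two children and whose leaves are in bijection with $C$; $d_T(c)$ is the depth of the leaf of $c$ (root has depth $0$). The code length is $\mathrm{len}(T)=\sum_{c\in C}\mathrm{freq}(c)\, d_T(c)$. A blocking scheme with $m$ block levels is a sequence $\langle (w_1,q_1),\dots,(w_m,q_m)\rangle$ of positive integer widths $w_j$ and access costs $q_j\ge0$. For a character $c$, let $W_T(c)$ be the smallest $h$ with $\sum_{j=1}^h w_j\ge d_T(c)$, and $\Delta_T(c)=\sum_{i\le W_T(c)} q_i$. The decode time is $\Delta(T)=\sum_{c\in C}\mathrm{freq}(c)\,\Delta_T(c)$. $\mathrm{DOPT}(\mathcal{L})$: find a prefix tree minimizing $\Delta(T)$ subject to $\mathrm{len}(T)\le\mathcal{L}$. *)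

(* Defs.v *)
From HB Require Import structures.
From mathcomp Require Import all_boot all_order all_algebra.

Set Implicit Arguments.
Unset Strict Implicit.
Unset Printing Implicit Defensive.

Import Order.TTheory GRing.Theory Num.Theory.

Local Open Scope ring_scope.

(* The alphabet of n characters is 'I_n. *)

Inductive btree (n : nat) : Type :=
  | Leaf of 'I_n
  | Node of btree n & btree n.

Fixpoint leaves n (T : btree n) : seq 'I_n :=
  match T with
  | Leaf c => [:: c]
  | Node l r => leaves l ++ leaves r
  end.

Definition prefix_tree n (T : btree n) : bool :=
  perm_eq (leaves T) (enum 'I_n).

(* Meaningful when c labels exactly one leaf of T, as in a prefix tree. *)
Fixpoint depth n (T : btree n) (c : 'I_n) : nat :=
  match T with
  | Leaf _ => 0
  | Node l r => (if c \in leaves l then depth l c else depth r c).+1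
  end.

Section Dopt.
Variable R : realFieldType.

Definition code_length n (freq : 'I_n -> R) (T : btree n) : R :=
  \sum_(c < n) freq c * (depth T c)%:R.

(* The list of the pairs (w_j, q_j), j = 1, ..., m. *)
Definition scheme := seq (nat * R).

Definition valid_scheme (s : scheme) : Prop :=
  forall p, p \in s -> (0 < p.1)%N /\ 0 <= p.2.

Definition total_width (s : scheme) (h : nat) : nat :=
  (\sum_(p <- take h s) p.1)%N.

(* The smallest h in {0, ..., m} whose first h blocks reach depth d.  There
   is none when d exceeds the total width of the scheme; the junk value m + 1
   produced by find is then excluded by [decodable]. *)
Definition block_level (s : scheme) (d : nat) : nat :=
  find (fun h => (d <= total_width s h)%N) (iota 0 (size s).+1).

Definition access_cost (s : scheme) (d : nat) : R :=
  \sum_(p <- take (block_level s d) s) p.2.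

Definition decode_time n (freq : 'I_n -> R) (s : scheme) (T : btree n) : R :=
  \sum_(c < n) freq c * access_cost s (depth T c).

(* Every character has a block level, so that the decode time is defined. *)
Definition decodable n (s : scheme) (T : btree n) : Prop :=
  forall c : 'I_n, (depth T c <= total_width s (size s))%N.

Definition feasible n (freq : 'I_n -> R) (s : scheme) (L : R) (T : btree n) :=
  [/\ prefix_tree T, decodable s T & code_length freq T <= L].

Definition dopt_solution n (freq : 'I_n -> R) (s : scheme) (L : R)
    (T : btree n) : Prop :=
  feasible freq s L T /\
  forall T' : btree n, feasible freq s L T' ->
    decode_time freq s T <= decode_time freq s T'.

End Dopt.

(* Machine model: a unit-cost real RAM, programmed by structured imperative
   programs.  The memory consists of natural-number arrays and of real arrays,
   all named by natural numbers and indexed by natural numbers; a scalar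
   variable is a cell of an array.  Natural numbers are only added,
   subtracted (with truncation) and compared: without multiplication, t steps
   create only numbers of O(t) bits more than the inputs, so that charging one
   unit per operation is not abusive.  Real numbers are added, subtracted,
   multiplied and compared; the only constants are 0 and 1 and there is no
   conversion from reals to naturals (no floor).  In particular the syntax of
   programs does not depend on the field R. *)

Inductive nexp : Type :=
  | NConst of nat
  | NGet of nat & nexp
  | NAdd of nexp & nexp
  | NSub of nexp & nexp.

Inductive rexp : Type :=
  | RZero
  | ROne
  | RGet of nat & nexp
  | RAdd of rexp & rexp
  | RSub of rexp & rexp
  | RMul of rexp & rexp.

Inductive bexp : Type :=
  | BNle of nexp & nexp
  | BRle of rexp & rexp
  | BNot of bexp
  | BAnd of bexp & bexp.

Inductive prog : Type :=
  | Skip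
  | NSet of nat & nexp & nexp
  | RSet of nat & nexp & rexp
  | Seq of prog & prog
  | If of bexp & prog & prog
  | While of bexp & prog.

Fixpoint ncost (e : nexp) : nat :=
  match e with
  | NConst _ => 1
  | NGet _ i => (ncost i).+1
  | NAdd e1 e2 | NSub e1 e2 => (ncost e1 + ncost e2).+1
  end.

Fixpoint rcost (e : rexp) : nat :=
  match e with
  | RZero | ROne => 1
  | RGet _ i => (ncost i).+1
  | RAdd e1 e2 | RSub e1 e2 | RMul e1 e2 => (rcost e1 + rcost e2).+1
  end.

Fixpoint bcost (b : bexp) : nat :=
  match b with
  | BNle e1 e2 => (ncost e1 + ncost e2).+1
  | BRle e1 e2 => (rcost e1 + rcost e2).+1
  | BNot b1 => (bcost b1).+1
  | BAnd b1 b2 => (bcost b1 + bcost b2).+1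
  end.

Definition update (V : Type) (f : nat -> nat -> V) (a i : nat) (v : V) :
    nat -> nat -> V :=
  fun b j => if (b == a) && (j == i) then v else f b j.

Section Machine.
Variable R : realFieldType.

Record memory : Type := Memory {
  nmem : nat -> nat -> nat;
  rmem : nat -> nat -> R
}.

Fixpoint neval (M : memory) (e : nexp) : nat :=
  match e with
  | NConst k => k
  | NGet a i => nmem M a (neval M i)
  | NAdd e1 e2 => (neval M e1 + neval M e2)%N
  | NSub e1 e2 => (neval M e1 - neval M e2)%N
  end.

Fixpoint reval (M : memory) (e : rexp) : R :=
  match e with
  | RZero => 0
  | ROne => 1
  | RGet a i => rmem M a (neval M i)
  | RAdd e1 e2 => reval M e1 + reval M e2
  | RSub e1 e2 => reval M e1 - reval M e2
  | RMul e1 e2 => reval M e1 * reval M e2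
  end.

Fixpoint beval (M : memory) (b : bexp) : bool :=
  match b with
  | BNle e1 e2 => (neval M e1 <= neval M e2)%N
  | BRle e1 e2 => reval M e1 <= reval M e2
  | BNot b1 => ~~ beval M b1
  | BAnd b1 b2 => beval M b1 && beval M b2
  end.

(* exec P M M' t: started in M, the program P halts in M' after t steps. *)
Inductive exec : prog -> memory -> memory -> nat -> Prop :=
  | ExecSkip M : exec Skip M M 1
  | ExecNSet a i e M :
      exec (NSet a i e) M
        (Memory (update (nmem M) a (neval M i) (neval M e)) (rmem M))
        (ncost i + ncost e).+1
  | ExecRSet a i e M :
      exec (RSet a i e) M
        (Memory (nmem M) (update (rmem M) a (neval M i) (reval M e)))
        (ncost i + rcost e).+1
  | ExecSeq P1 P2 M1 M2 M3 t1 t2 :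
      exec P1 M1 M2 t1 -> exec P2 M2 M3 t2 ->
      exec (Seq P1 P2) M1 M3 (t1 + t2)
  | ExecIf b P1 P2 M M' t :
      exec (if beval M b then P1 else P2) M M' t ->
      exec (If b P1 P2) M M' (bcost b + t).+1
  | ExecWhileFalse b P M :
      ~~ beval M b -> exec (While b P) M M (bcost b).+1
  | ExecWhileTrue b P M1 M2 M3 t1 t2 :
      beval M1 b -> exec P M1 M2 t1 -> exec (While b P) M2 M3 t2 ->
      exec (While b P) M1 M3 (bcost b + t1 + t2).+1.

Lemma exec_det P M M1 M2 t1 t2 :
  exec P M M1 t1 -> exec P M M2 t2 -> M1 = M2 /\ t1 = t2.
Proof.
move=> E; elim: E M2 t2 => {P M M1 t1}.
- by move=> M M2 t2 E; inversion E.
- by move=> a i e M M2 t2 E; inversion E.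
- by move=> a i e M M2 t2 E; inversion E.
- move=> P1 P2 A B C t t' _ IH1 _ IH2 M2 t2 E.
  inversion E as [| | |? ? ? A' ? u u' E1 E2| | |]; subst.
  by have [? ?] := IH1 _ _ E1; subst; have [-> ->] := IH2 _ _ E2.
- move=> b P1 P2 A B t _ IH M2 t2 E.
  inversion E as [| | | |? ? ? ? ? u E1| |]; subst.
  by have [-> ->] := IH _ _ E1.
- move=> b P A nb M2 t2 E.
  by inversion E as [| | | | | |? ? ? ? ? ? ? Ab]; subst=> //; rewrite Ab in nb.
- move=> b P A B C t t' Ab _ IH1 _ IH2 M2 t2 E.
  inversion E as [| | | | |? ? ? nb|? ? ? A' ? u u' _ E1 E2]; subst.
    by rewrite Ab in nb.
  by have [? ?] := IH1 _ _ E1; subst; have [-> ->] := IH2 _ _ E2.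
Qed.

End Machine.

(* Input: natural arrays 0 and 1 hold n and m in cell 0, natural array 2 holds
   the widths; real arrays 0, 1 and 2 hold the frequencies, the access costs
   and (in cell 0) the bound on the code length.  All other cells are 0. *)
Definition input_memory (R : realFieldType) n (freq : 'I_n -> R)
    (s : scheme R) (L : R) : memory R :=
  Memory
    (fun a i =>
      match a, i with
      | 0%N, 0%N => n
      | 1%N, 0%N => size s
      | 2%N, _ => (nth (0%N, 0) s i).1
      | _, _ => 0%N
      end)
    (fun a i =>
      match a, i with
      | 0%N, _ => oapp freq 0 (insub i)
      | 1%N, _ => (nth (0%N, 0) s i).2
      | 2%N, 0%N => L
      | _, _ => 0
      end).

(* Output: cell 0 of natural array 3 tells whether a tree is returned, cell 0
   of natural array 4 is the root of that tree.  A node is a number x; entry x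
   of arrays 5, 6, 7 and 8 holds respectively whether x is internal, its left
   child, its right child, and its character if it is a leaf. *)
Fixpoint stored_tree (R : realFieldType) n (M : memory R) (x : nat)
    (T : btree n) : Prop :=
  match T with
  | Leaf c => nmem M 5 x = 0%N /\ nmem M 8 x = c
  | Node l r =>
      [/\ nmem M 5 x = 1%N,
          stored_tree M (nmem M 6 x) l & stored_tree M (nmem M 7 x) r]
  end.

Definition correct_output (R : realFieldType) n (freq : 'I_n -> R)
    (s : scheme R) (L : R) (M : memory R) : Prop :=
  (nmem M 3 0 = 1%N /\
     exists T : btree n,
       stored_tree M (nmem M 4 0) T /\ dopt_solution freq s L T)
  \/
  (nmem M 3 0 = 0%N /\ forall T : btree n, ~ feasible freq s L T).

(* Main.v *)
Require Import Defs.
From HB Require Import structures.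
From mathcomp Require Import all_boot all_order all_algebra.
From mathcomp Require Import zify lra.

Set Implicit Arguments.
Unset Strict Implicit.
Unset Printing Implicit Defensive.

Import Order.TTheory GRing.Theory Num.Theory.

(* Rank the characters by decreasing frequency.  By the rearrangement inequality
   an optimal tree may be assumed to have nondecreasing depths along this
   ranking, so the block levels of the characters are nondecreasing too and are
   encoded by m thresholds in {0, ..., n}.  For each of the (n + 1)^m threshold
   vectors the decode time is bounded by a fixed number, and it remains to find
   the shortest tree in which every character respects the depth bound given by
   its level.  This is a dynamic program over the O(n^3) states (d, i, k): the
   construction has reached depth d, the first i characters are placed, and k
   nodes of depth d are open.  One either places the next character on an open
   node or makes all open nodes internal.  Full binary trees correspond to the
   depth sequences with Kraft sum 1, which are exactly the sequences produced
   by such steps. *)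

(** Length and decode time are both sums of a frequency times a function of the depth that is
    nondecreasing on decodable depths, so one reordering of the depths improves both at once. No
    tree with the reordered depths is built: the Kraft sum is unchanged, and it alone steers the
    recurrence. The time attached to a vector is only an upper bound for the trees found under it,
    since a character may sit higher than its level allows. Conversely, the vector read off a
    feasible tree after reordering has a time no larger than the decode time of that tree. Together
    the two inequalities make the least vector time the optimum. Each of the (n + 1)^m vectors costs
    a table of (n + 1)^3 cells, filled in constant time per cell; reconstructing a tree takes O(n^2)
    and is absorbed. The remaining difficulty is the explicit machine: termination, result and step
    count are derived together in a small program logic, which also tracks the arrays that a program
    leaves untouched. *)

Fixpoint nat_writes (P : prog) : seq nat :=
  match P with
  | Skip | RSet _ _ _ => [::]
  | NSet a _ _ => [:: a]
  | Seq P1 P2 | If _ P1 P2 => nat_writes P1 ++ nat_writes P2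
  | While _ P1 => nat_writes P1
  end.

Fixpoint real_writes (P : prog) : seq nat :=
  match P with
  | Skip | NSet _ _ _ => [::]
  | RSet a _ _ => [:: a]
  | Seq P1 P2 | If _ P1 P2 => real_writes P1 ++ real_writes P2
  | While _ P1 => real_writes P1
  end.

Fixpoint loop_free (P : prog) : bool :=
  match P with
  | Skip | NSet _ _ _ | RSet _ _ _ => true
  | Seq P1 P2 | If _ P1 P2 => loop_free P1 && loop_free P2
  | While _ _ => false
  end.

(* An upper bound for loop-free programs only; loops get the junk value 0. *)
Fixpoint max_cost (P : prog) : nat :=
  match P with
  | Skip => 1
  | NSet _ i e => (ncost i + ncost e).+1
  | RSet _ i e => (ncost i + rcost e).+1
  | Seq P1 P2 => max_cost P1 + max_cost P2
  | If b P1 P2 => (bcost b + (max_cost P1 + max_cost P2)).+1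
  | While _ _ => 0
  end.

(** Each scalar variable owns a whole array, so framing array by array is enough to separate any two
    variables and reduces to a computation on array numbers. *)
Definition cell (x : nat) : nexp := NGet x (NConst 0).

Definition For (x : nat) (e : nexp) (P : prog) : prog :=
  Seq (NSet x (NConst 0) (NConst 0))
      (While (BNle (NAdd (cell x) (NConst 1)) e)
         (Seq P (NSet x (NConst 0) (NAdd (cell x) (NConst 1))))).

(** * Timed weakest preconditions *)

Section Logic.
Variable R : realFieldType.
Implicit Types (P : prog) (M : memory R) (Q : memory R -> Prop).

Definition framed (ns rs : seq nat) M M' : Prop :=
  (forall a i, a \notin ns -> nmem M' a i = nmem M a i) /\
  (forall a i, a \notin rs -> rmem M' a i = rmem M a i).

Definition frame P := framed (nat_writes P) (real_writes P).

Lemma framed_refl ns rs M : framed ns rs M M.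
Proof. by []. Qed.

Lemma framed_trans ns rs M1 M2 M3 :
  framed ns rs M1 M2 -> framed ns rs M2 M3 -> framed ns rs M1 M3.
Proof.
by move=> [n12 r12] [n23 r23]; split=> a i na; rewrite ?n23 ?n12 ?r23 ?r12.
Qed.

Lemma framed_sub ns rs ns' rs' M M' :
  {subset ns <= ns'} -> {subset rs <= rs'} ->
  framed ns rs M M' -> framed ns' rs' M M'.
Proof.
move=> sn sr [n12 r12]; split=> a i na; [apply: n12|apply: r12].
  by apply: contra na => /sn.
by apply: contra na => /sr.
Qed.

Lemma exec_frame P M M' t : exec P M M' t -> frame P M M'.
Proof.
elim=> {P M M' t} //.
- move=> a i e M; split=> //= b j; rewrite inE /update => /negbTE nb.
  by rewrite nb.
- move=> a i e M; split=> //= b j; rewrite inE /update => /negbTE nb.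
  by rewrite nb.
- move=> P1 P2 M1 M2 M3 t1 t2 _ f1 _ f2; rewrite /frame /=.
  apply: framed_trans (framed_sub _ _ f1) (framed_sub _ _ f2) => x;
    by rewrite mem_cat => ->; rewrite ?orbT.
- move=> b P1 P2 M M' t _; rewrite /frame /=; case: ifP => _;
    by apply: framed_sub => x; rewrite mem_cat => ->; rewrite ?orbT.
- by move=> b P M1 M2 M3 t1 t2 _ _ f1 _ f2; apply: framed_trans f1 f2.
Qed.

Definition wp P M (T : nat) Q : Prop :=
  exists M' t, [/\ exec P M M' t, t <= T & Q M'].

(** The frame is handed to the new postcondition for free, so specifications list only what
    changes. *)
Lemma wp_weaken P M T T' Q Q' :
  wp P M T Q -> T <= T' -> (forall M', frame P M M' -> Q M' -> Q' M') ->
  wp P M T' Q'.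
Proof.
move=> [M' [t [E tT QM]]] TT' QQ'; exists M', t; split=> //.
  exact: leq_trans TT'.
by apply: QQ' QM; apply: exec_frame E.
Qed.

Lemma wp_seq P1 P2 M T1 T2 Q :
  wp P1 M T1 (fun M1 => wp P2 M1 T2 Q) -> wp (Seq P1 P2) M (T1 + T2) Q.
Proof.
move=> [M1 [t1 [E1 l1 [M2 [t2 [E2 l2 QM]]]]]].
by exists M2, (t1 + t2); split=> //; [apply: ExecSeq E1 E2|apply: leq_add].
Qed.

Lemma wp_seq_mid P1 P2 M T1 T2 Q1 Q :
  wp P1 M T1 Q1 -> (forall M1, frame P1 M M1 -> Q1 M1 -> wp P2 M1 T2 Q) ->
  wp (Seq P1 P2) M (T1 + T2) Q.
Proof. by move=> H1 H2; apply: wp_seq; apply: wp_weaken H1 (leqnn _) H2. Qed.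

Lemma wp_if b P1 P2 M T Q :
  wp (if beval M b then P1 else P2) M T Q ->
  wp (If b P1 P2) M (bcost b + T).+1 Q.
Proof.
move=> [M1 [t1 [E1 l1 QM]]]; exists M1, (bcost b + t1).+1.
by split=> //; [apply: ExecIf|rewrite ltnS leq_add2l].
Qed.

Lemma wp_while_false b P M Q :
  ~~ beval M b -> Q M -> wp (While b P) M (bcost b).+1 Q.
Proof. by move=> nb QM; exists M, (bcost b).+1; split=> //; constructor. Qed.

Lemma wp_while_true b P M T1 T2 Q :
  beval M b -> wp P M T1 (fun M1 => wp (While b P) M1 T2 Q) ->
  wp (While b P) M (bcost b + T1 + T2).+1 Q.
Proof.
move=> Mb [M1 [t1 [E1 l1 [M2 [t2 [E2 l2 QM]]]]]].
exists M2, (bcost b + t1 + t2).+1; split=> //; last by lia.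
exact: ExecWhileTrue Mb E1 E2.
Qed.

Definition set_nat M x i v : memory R :=
  Memory (update (nmem M) x i v) (rmem M).

(** Running a loop-free program as a function lets simplification compute its final memory. The
    identity on loops is a default, excluded by [loop_free] in [wp_step]. *)
Fixpoint step P M : memory R :=
  match P with
  | Skip | While _ _ => M
  | NSet a i e =>
      Memory (update (nmem M) a (neval M i) (neval M e)) (rmem M)
  | RSet a i e =>
      Memory (nmem M) (update (rmem M) a (neval M i) (reval M e))
  | Seq P1 P2 => step P2 (step P1 M)
  | If b P1 P2 => if beval M b then step P1 M else step P2 M
  end.

Lemma wp_step P M T Q :
  loop_free P -> max_cost P <= T -> Q (step P M) -> wp P M T Q.
Proof.
move=> lfP leT QM.
suff [t [E lt]] : exists t, exec P M (step P M) t /\ t <= max_cost P.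
  by exists (step P M), t; split=> //; apply: leq_trans leT.
elim: P M lfP {QM leT} => //=.
- by move=> M _; exists 1; split=> //; constructor.
- by move=> a i e M _; exists (ncost i + ncost e).+1; split=> //; constructor.
- by move=> a i e M _; exists (ncost i + rcost e).+1; split=> //; constructor.
- move=> P1 IH1 P2 IH2 M /andP [/(IH1 M) [t1 [E1 l1]] /(IH2 (step P1 M)) [t2 [E2 l2]]].
  by exists (t1 + t2); split; [apply: ExecSeq E1 E2|apply: leq_add].
move=> b P1 IH1 P2 IH2 M /andP [/(IH1 M) [t1 [E1 l1]] /(IH2 M) [t2 [E2 l2]]].
exists (bcost b + (if beval M b then t1 else t2)).+1.
split; first by apply: ExecIf; case: ifP.
by case: ifP; lia.
Qed.

Lemma step_frame P M : frame P M (step P M).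
Proof.
rewrite /frame; elim: P M => //= [a i e|a i e|P1 IH1 P2 IH2|b P1 IH1 P2 IH2] M.
- by split=> //= b j; rewrite inE /update => /negbTE ->.
- by split=> //= b j; rewrite inE /update => /negbTE ->.
- apply: framed_trans (framed_sub _ _ (IH1 _)) (framed_sub _ _ (IH2 _)) => x;
    by rewrite mem_cat => ->; rewrite ?orbT.
- by case: ifP => _; [apply: framed_sub (IH1 _)|apply: framed_sub (IH2 _)] => x;
    rewrite mem_cat => ->; rewrite ?orbT.
Qed.

Lemma wp_step_frame P M T Q :
  loop_free P -> max_cost P <= T ->
  (forall M', M' = step P M -> frame P M M' -> Q M') -> wp P M T Q.
Proof. by move=> lfP leT QM; apply: wp_step => //; apply: QM (step_frame _ _). Qed.

(** A turn spends [ncost e + 5] on the test, 6 on the increment and 1 on the loop itself, 12 being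
    rounded up to 15. The extra turn in [k.+1] pays for the initialization and the final failing
    test. *)
Definition for_cost (e : nexp) (k T : nat) : nat := k.+1 * (T + ncost e + 15).

(** The invariant speaks of the memory at the loop head, where the counter already equals its index;
    hence the body is asked to establish it after the counter has been bumped to [j.+1]. *)
Lemma wp_for x e P M k T (I : nat -> memory R -> Prop) :
  x \notin nat_writes P ->
  (forall j M1, I j M1 -> frame (For x e P) M M1 -> neval M1 e = k) ->
  I 0 (set_nat M x 0 0) ->
  (forall j M1, j < k -> nmem M1 x 0 = j -> frame (For x e P) M M1 -> I j M1 ->
     wp P M1 T (fun M2 => I j.+1 (set_nat M2 x 0 j.+1))) ->
  wp (For x e P) M (for_cost e k T)
     (fun M' => [/\ I k M', nmem M' x 0 = k & frame (For x e P) M M']).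
Proof.
move=> xP Ie I0 IS.
have fx M1 j : frame (For x e P) M M1 -> frame (For x e P) M (set_nat M1 x 0 j).
  move=> [fn fr]; split=> a i na /=; last by apply: fr.
  move: (na); rewrite /= inE negb_or /update => /andP [/negbTE -> _] /=.
  exact: fn.
pose loop := While (BNle (NAdd (cell x) (NConst 1)) e)
  (Seq P (NSet x (NConst 0) (NAdd (cell x) (NConst 1)))).
have H f j M1 : j + f = k -> nmem M1 x 0 = j -> frame (For x e P) M M1 -> I j M1 ->
    wp loop M1 (f.+1 * (T + ncost e + 15) - 5)
     (fun M' => [/\ I k M', nmem M' x 0 = k & frame (For x e P) M M']).
  rewrite /loop; elim: f j M1 => [|f IH] j M1 jk Mj fM1 IM.
    rewrite addn0 in jk; rewrite -jk.
    have nb : ~~ beval M1 (BNle (NAdd (cell x) (NConst 1)) e).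
      by rewrite /= (Ie _ _ IM) // Mj; lia.
    apply: (wp_weaken (wp_while_false _ nb
      (Q := fun M' => [/\ I j M', nmem M' x 0 = j & frame (For x e P) M M']) _)) => //.
    by rewrite /=; lia.
  have bM : beval M1 (BNle (NAdd (cell x) (NConst 1)) e).
    by rewrite /= (Ie _ _ IM) // Mj; lia.
  have jlt : j < k by lia.
  apply: wp_weaken (wp_while_true bM (T1 := T + 6)
    (T2 := f.+1 * (T + ncost e + 15) - 5) (Q := fun M' =>
        [/\ I k M', nmem M' x 0 = k & frame (For x e P) M M']) _) _ _ => //.
  - apply: wp_seq; apply: wp_weaken (IS j M1 jlt Mj fM1 IM) (leqnn _) _.
    move=> M2 fM2 IM2; apply: wp_step => //=.
    have M2j : nmem M2 x 0 = j by rewrite fM2.1.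
    rewrite M2j addn1; apply: (IH j.+1) => //; first by lia.
    + by rewrite /= /update !eqxx.
    + apply: fx; apply: framed_trans fM1 (framed_sub _ _ fM2) => y /=.
        by move=> yP; rewrite inE mem_cat yP orbT.
      by rewrite cats0.
  - by rewrite /=; lia.
have -> : for_cost e k T = 3 + (for_cost e k T - 3) by rewrite /for_cost; lia.
apply: wp_seq; apply: wp_step => //=.
apply: wp_weaken (H k 0 (set_nat M x 0 0) _ _ _ I0) _ _ => //.
- by rewrite /= /update !eqxx.
- by apply: fx; apply: framed_refl.
- by rewrite /for_cost; lia.
Qed.

End Logic.

(** Powers of [n.+1] instead of [n] make constants bounded at every degree, also at 0, and match
    loops with n + 1 turns; the final theorem converts them back. *)
Definition poly_bounded (k : nat) (T : nat -> nat) : Prop :=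
  exists c, forall n, T n <= c * n.+1 ^ k.

Lemma poly_bounded_const k c : poly_bounded k (fun=> c).
Proof. by exists c => n; rewrite leq_pmulr // expn_gt0. Qed.

Lemma poly_boundedD k T1 T2 :
  poly_bounded k T1 -> poly_bounded k T2 ->
  poly_bounded k (fun n => T1 n + T2 n).
Proof.
by move=> [c1 H1] [c2 H2]; exists (c1 + c2) => n; rewrite mulnDl leq_add.
Qed.

Lemma poly_boundedM k1 k2 T1 T2 :
  poly_bounded k1 T1 -> poly_bounded k2 T2 ->
  poly_bounded (k1 + k2) (fun n => T1 n * T2 n).
Proof.
move=> [c1 H1] [c2 H2]; exists (c1 * c2) => n.
by rewrite expnD mulnACA leq_mul.
Qed.

Lemma poly_bounded_le k k' T : k <= k' -> poly_bounded k T -> poly_bounded k' T.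
Proof.
move=> kk' [c H]; exists c => n; apply: leq_trans (H n) _.
by rewrite leq_mul2l leq_pexp2l ?orbT.
Qed.

Lemma poly_bounded_linear c (b : nat -> nat) :
  (forall n, b n <= c * n.+1) -> poly_bounded 1 b.
Proof. by exists c => n; rewrite expn1. Qed.

Lemma poly_bounded_for k e c T (b : nat -> nat) :
  (forall n, b n <= c * n.+1) -> poly_bounded k T ->
  poly_bounded k.+1 (fun n => for_cost e (b n) (T n)).
Proof.
move=> bn HT; apply: (poly_boundedM (k1 := 1)).
  by apply: (@poly_bounded_linear c.+1) => n; rewrite mulSn -addn1 addnC leq_add.
by apply/poly_boundedD/poly_bounded_const/poly_boundedD/poly_bounded_const.
Qed.

(** * Rearrangement, Kraft sums and the dynamic program *)

Section Rearrangement.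
Local Open Scope ring_scope.
Variables (R : realFieldType) (g : nat -> R).
Hypothesis g_mono : forall x y, (x <= y)%N -> g x <= g y.

Fixpoint weighted_sum (F : nat -> R) (xs : seq nat) : R :=
  if xs is x :: xs' then F 0%N * g x + weighted_sum (fun i => F i.+1) xs'
  else 0.

Lemma weighted_sumE F xs :
  weighted_sum F xs = \sum_(0 <= i < size xs) F i * g (nth 0%N xs i).
Proof.
elim: xs F => [|x xs IH] F /=; first by rewrite big_geq.
by rewrite big_nat_recl // IH.
Qed.

Fixpoint insert (x : nat) (xs : seq nat) : seq nat :=
  if xs is y :: xs' then
    if (x <= y)%N then x :: xs else y :: insert x xs'
  else [:: x].

Lemma insert_perm x xs : perm_eq (insert x xs) (x :: xs).
Proof.
elim: xs => //= y xs IH; case: ifP => // _.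
rewrite -(perm_cons y) in IH; apply: perm_trans IH _.
by apply/permP => a /=; rewrite addnCA.
Qed.

Lemma insert_sorted x xs : sorted leq xs -> sorted leq (insert x xs).
Proof.
elim: xs => //= y xs IH ys; case: ifP => [xy|/negbT xy] /=; first by rewrite xy.
rewrite (path_sortedE leq_trans).
move: ys; rewrite (path_sortedE leq_trans) => /andP [ay sxs].
rewrite IH // andbT (perm_all _ (insert_perm x xs)) /= ay andbT.
by rewrite -ltnNge in xy; apply: ltnW.
Qed.

Definition insertion_sort : seq nat -> seq nat := foldr insert [::].

Lemma insertion_sort_perm xs : perm_eq (insertion_sort xs) xs.
Proof.
elim: xs => //= x xs IH; apply: perm_trans (insert_perm _ _) _.
by rewrite perm_cons.
Qed.

Lemma insertion_sort_sorted xs : sorted leq (insertion_sort xs).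
Proof. by elim: xs => //= x xs IH; apply: insert_sorted. Qed.

(** Moving [x] past a smaller [y] replaces F 0 g x + F 1 g y by F 0 g y + F 1 g x, a gain of (F 0 -
    F 1)(g x - g y), which is nonnegative. *)
Lemma insert_weighted_sum F x xs :
  (forall i j, (i <= j)%N -> (j <= size xs)%N -> F j <= F i) ->
  weighted_sum F (insert x xs) <= weighted_sum F (x :: xs).
Proof.
elim: xs F => //= y xs IH F F_anti; case: ifP => //= /negbT xy.
have := IH (fun i => F i.+1) (fun i j ij js => F_anti i.+1 j.+1 ij js).
rewrite /=; move: (weighted_sum _ _) (weighted_sum _ _) => a b ab.
have F10 := F_anti 0%N 1%N isT isT.
have gyx : g y <= g x by apply: g_mono; rewrite -ltnNge in xy; apply: ltnW.
have : 0 <= (F 0%N - F 1%N) * (g x - g y) by apply: mulr_ge0; rewrite subr_ge0.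
nra.
Qed.

(** The sorted list does not depend on [g], so the same rearrangement can be used for the length and
    for the decode time. *)
Lemma insertion_sort_weighted_sum F xs :
  (forall i j, (i <= j)%N -> (j < size xs)%N -> F j <= F i) ->
  weighted_sum F (insertion_sort xs) <= weighted_sum F xs.
Proof.
elim: xs F => //= x xs IH F F_anti.
apply: le_trans (insert_weighted_sum _ _) _.
  by rewrite (perm_size (insertion_sort_perm xs)).
rewrite /= lerD2l; apply: (IH (fun i => F i.+1)) => i j ij js.
exact: F_anti.
Qed.

End Rearrangement.

(** * Kraft's equality and forests of trees *)

Section Trees.
Variable n : nat.
Implicit Types T : btree n.

Lemma depth_lt_leaves T c : c \in leaves T -> depth T c < size (leaves T).
Proof.
have pos (U : btree n) : 0 < size (leaves U).
  by elim: U => //= l Hl r Hr; rewrite size_cat addn_gt0 Hl.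
elim: T => //= l IHl r IHr; rewrite mem_cat size_cat.
case: ifP => [/IHl|_ /IHr]; have := pos l; have := pos r; lia.
Qed.

(** Scaling by 2^N keeps Kraft's equality in the natural numbers; each subtree of the root accounts
    for half of it. *)
Lemma kraft_sum T N : uniq (leaves T) ->
  (forall c, c \in leaves T -> depth T c <= N) ->
  \sum_(c <- leaves T) 2 ^ (N - depth T c) = 2 ^ N.
Proof.
elim: T N => [c|l IHl r IHr] N /=; first by rewrite big_seq1 subn0.
rewrite cat_uniq => /and3P [ul /hasPn lr ur] leN.
(* A leaf of the left subtree has depth at least 1 in the whole tree, so [N] is positive and the
   induction hypotheses apply at its predecessor. *)
have [c0 c0l] : exists c0, c0 \in leaves l.
  by elim: {+}l => [c|l1 [c H] l2 _]; exists c; rewrite /= ?inE // mem_cat H.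
have := leN c0; rewrite mem_cat c0l => /(_ isT).
case: N leN => // N leN _.
rewrite big_cat /= expnS mul2n -addnn; congr (_ + _).
- rewrite -(IHl N) // => [|c cl].
    by rewrite !big_seq; apply: eq_bigr => c cl; rewrite cl subSS.
  by have := leN c; rewrite mem_cat cl; apply.
- rewrite -(IHr N) // => [|c cr].
    rewrite !big_seq; apply: eq_bigr => c cr.
    by rewrite (negbTE (lr c cr)) subSS.
  have := leN c; rewrite mem_cat cr orbT (negbTE (lr c cr)); exact.
Qed.

(** Undoes a deepening step: consecutive roots at depth d + 1 become the two children of a root at
    depth d. *)
Fixpoint pair_up (k : nat) (fs : seq (btree n)) : seq (btree n) :=
  match k, fs with
  | k'.+1, T1 :: T2 :: fs' => Node T1 T2 :: pair_up k' fs'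
  | _, _ => [::]
  end.

Definition forest_leaves (fs : seq (btree n)) : seq 'I_n :=
  flatten (map (@leaves n) fs).

Lemma size_pair_up k fs : size fs = k + k -> size (pair_up k fs) = k.
Proof.
elim: k fs => [|k IH] [|T1 [|T2 fs]] //=; try lia.
by move=> sz; rewrite IH //; lia.
Qed.

Lemma leaves_pair_up k fs :
  size fs = k + k -> forest_leaves (pair_up k fs) = forest_leaves fs.
Proof.
rewrite /forest_leaves.
elim: k fs => [|k IH] [|T1 [|T2 fs]] //=; try lia.
by move=> sz; rewrite IH ?catA //; lia.
Qed.

Fixpoint depths_are (d : nat) (delta : 'I_n -> nat) (fs : seq (btree n)) : Prop :=
  if fs is T :: fs' then
    (forall c, c \in leaves T -> d + depth T c = delta c) /\
    depths_are d delta fs'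
  else True.

Lemma depths_are_pair_up d delta k fs :
  depths_are d.+1 delta fs -> depths_are d delta (pair_up k fs).
Proof.
elim: k fs => [|k IH] [|T1 [|T2 fs]] //= [H1 [H2 Hfs]].
split; last exact: IH.
move=> c; rewrite mem_cat addnS -addSn; case: ifP => [cT1 _|_ /= cT2].
  exact: H1.
exact: H2.
Qed.

Lemma eq_depths_are d delta delta' fs :
  {in forest_leaves fs, delta =1 delta'} ->
  depths_are d delta fs -> depths_are d delta' fs.
Proof.
elim: fs => //= T fs IH ed [HT Hfs]; split.
  by move=> c cT; rewrite HT // ed // /forest_leaves /= mem_cat cT.
by apply: IH Hfs => c cfs; apply: ed; rewrite /forest_leaves /= mem_cat cfs orbT.
Qed.

End Trees.

(** * The recurrence for fixed depth bounds *)

Section DynamicProgram.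
Local Open Scope ring_scope.
Variables (R : realFieldType) (n : nat) (U : nat -> nat) (F : nat -> R) (L : R).

(* Dead ends get the value L + 1: the other contributions are nonnegative, so a
   value is at most L exactly when a construction of length at most L exists. *)
Definition place_value (v : nat -> nat -> nat -> R) (d i k : nat) : R :=
  if (k <= 0)%N then (if (n <= i)%N then 0 else L + 1)
  else if (i + 1 <= n)%N && (d <= U i)%N
  then F i * d%:R + v d (i + 1)%N (k - 1)%N else L + 1.

(** Every open node will carry at least one of the n - i remaining characters, which justifies the
    bound on [k + k] and keeps table indices at most n. Abstraction over [v] lets the same formula
    describe the recursion and the reading of a partly filled table. *)
Definition deepen_value (v : nat -> nat -> nat -> R) (d i k : nat) : R :=
  if (k <= 0)%N then L + 1
  else if (d + 1 <= n)%N && (k + k <= n - i)%N then v (d + 1)%N i (k + k)%N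
  else L + 1.

(** The fuel is the number of remaining depths plus that of remaining characters, and each kind of
    step uses up one of them. Started as in [value], the recursion never reads the default 0. *)
Fixpoint value_rec (t d i k : nat) : R :=
  let v := if t is t'.+1 then value_rec t' else fun _ _ _ => 0 in
  let p := place_value v d i k in
  let q := deepen_value v d i k in
  if p <= q then p else q.

Definition value (d i k : nat) : R := value_rec (n - d + (n - i)) d i k.

Lemma place_value_ext v v' d i k :
  ((i < n)%N -> v d (i + 1)%N (k - 1)%N = v' d (i + 1)%N (k - 1)%N) ->
  place_value v d i k = place_value v' d i k.
Proof.
move=> vv'; rewrite /place_value; case: ifP => // _; case: ifP => //.
by move=> /andP [i_n _]; rewrite vv' // -addn1.
Qed.

Lemma deepen_value_ext v v' d i k :
  ((0 < k)%N -> (d < n)%N -> (k + k <= n)%N ->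
     v (d + 1)%N i (k + k)%N = v' (d + 1)%N i (k + k)%N) ->
  deepen_value v d i k = deepen_value v' d i k.
Proof.
move=> vv'; rewrite /deepen_value; case: ifP => // k0; case: ifP => //.
by move=> /andP [d_n kk]; rewrite vv' //; lia.
Qed.

Lemma valueE d i k : (d <= n)%N ->
  value d i k =
  if place_value value d i k <= deepen_value value d i k
  then place_value value d i k else deepen_value value d i k.
Proof.
move=> dn; rewrite {1}/value.
have E t : t = (n - d + (n - i))%N ->
  value_rec t d i k =
    if place_value value d i k <= deepen_value value d i k
    then place_value value d i k else deepen_value value d i k.
  move=> tE; have -> : place_value value d i k =
      place_value (if t is t'.+1 then value_rec t' else fun _ _ _ => 0) d i k.
    apply: place_value_ext => i_n; case: t tE => [|t] tE; first lia.
    by rewrite /value; congr value_rec; lia.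
  have -> : deepen_value value d i k =
      deepen_value (if t is t'.+1 then value_rec t' else fun _ _ _ => 0) d i k.
    apply: deepen_value_ext => _ d_n _; case: t tE => [|t] tE; first lia.
    by rewrite /value; congr value_rec; lia.
  by case: t {tE}.
exact: E.
Qed.

Lemma value_le_place d i k : (d <= n)%N ->
  value d i k <= place_value value d i k.
Proof. by move=> dn; rewrite valueE //; case: (lerP (place_value _ _ _ _)) => // /ltW. Qed.

Lemma value_le_deepen d i k : (d <= n)%N ->
  value d i k <= deepen_value value d i k.
Proof. by move=> dn; rewrite valueE //; case: (lerP (place_value _ _ _ _)). Qed.

(* Kraft's equality for the remaining leaves says that the open nodes are
   exactly filled; it determines the next step of the dynamic program. *)
Lemma value_le_depths (delta : nat -> nat) d i k :
  (i <= n)%N -> (d <= n)%N ->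
  (forall i' j, (i' <= j)%N -> (j < n)%N -> (delta i' <= delta j)%N) ->
  (forall j, (i <= j < n)%N -> [/\ d <= delta j, delta j <= n & delta j <= U j]%N) ->
  (\sum_(i <= j < n) 2 ^ (n - delta j) = k * 2 ^ (n - d))%N ->
  value d i k <= \sum_(i <= j < n) F j * (delta j)%:R.
Proof.
move=> i_n d_n delta_mono.
(* Without characters the Kraft sum is 0, so no node is open and the value is not a dead end. *)
have finished d' k' : (d' <= n)%N ->
    (\sum_(n <= j < n) 2 ^ (n - delta j) = k' * 2 ^ (n - d'))%N ->
    value d' n k' <= \sum_(n <= j < n) F j * (delta j)%:R.
  move=> d_n'; rewrite !big_geq // => kraft.
  apply: le_trans (value_le_place _ _ d_n') _.
  have -> : k' = 0%N by have := expn_gt0 2 (n - d'); nia.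
  by rewrite /place_value !leqnn.
move: {2}(n - d + (n - i))%N (leqnn (n - d + (n - i))%N) => t.
elim: t d i k i_n d_n => [|t IH] d i k i_n d_n tle bnd kraft.
  have E : i = n by lia.
  by move: kraft; rewrite E; apply: finished.
case: (ltnP i n) => [i_lt|n_i]; last first.
  have E : i = n by lia.
  by move: kraft; rewrite E; apply: finished.
move: {bnd} (bnd) (bnd i); rewrite leqnn i_lt => bnd /(_ isT) [d_i i_le i_U].
have k0 : (0 < k)%N.
  rewrite lt0n; apply/eqP => k0; move: kraft; rewrite k0 mul0n big_ltn //.
  by have := expn_gt0 2 (n - delta i); lia.
case: (ltnP d (delta i)) => [dlt|dge].
  have d_lt : (d < n)%N by lia.
  have bnd' j : (i <= j < n)%N -> [/\ d.+1 <= delta j, delta j <= n & delta j <= U j]%N.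
    move=> ij; have [_ H1 H2] := bnd j ij; split=> //.
    by apply: leq_trans dlt (delta_mono _ _ _ _); lia.
  have E : (2 ^ (n - d) = 2 * 2 ^ (n - d.+1))%N by rewrite -expnS; congr expn; lia.
  (* Each remaining character contributes at most 2^(n - d - 1) to a sum equal to 2k times that
     power, so at least 2k characters remain. *)
  have kk : (k + k <= n - i)%N.
    have : (\sum_(i <= j < n) 2 ^ (n - delta j) <= \sum_(i <= j < n) 2 ^ (n - d.+1))%N.
      rewrite big_nat [X in (_ <= X)%N]big_nat; apply: leq_sum => j /bnd' [H _ _].
      by rewrite leq_exp2l //; lia.
    rewrite kraft sum_nat_const_nat E.
    by have := expn_gt0 2 (n - d.+1); nia.
  apply: le_trans (value_le_deepen _ _ d_n) _; rewrite /deepen_value.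
  rewrite leqNgt k0 /= addn1 d_lt kk /=; apply: IH => //; first by lia.
  by rewrite kraft E; lia.
have Ed : delta i = d by lia.
apply: le_trans (value_le_place _ _ d_n) _; rewrite /place_value.
rewrite leqNgt k0 /= addn1 i_lt -{1}Ed i_U /= big_ltn // Ed lerD2l.
apply: IH => //; first by lia.
  by move=> j ij; apply: bnd; lia.
move: kraft; rewrite big_ltn // Ed; nia.
Qed.

(** A value at most [L] is not the dead-end mark [L + 1], so the guard of the selected branch must
    hold. This lemma and the next two are the case analysis that the reconstruction follows. *)
Lemma value_done d i : (d <= n)%N -> (i <= n)%N -> value d i 0 <= L ->
  i = n /\ value d i 0 = 0.
Proof.
move=> d_n i_n; rewrite valueE // /place_value /deepen_value !leqnn.
case: leqP => [n_i|_]; last by rewrite lexx gerDl ler10.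
case: ifP => [_ _|_]; last by rewrite gerDl ler10.
by split=> //; apply/eqP; rewrite eqn_leq i_n n_i.
Qed.

Lemma value_place d i k : (d <= n)%N -> (0 < k)%N -> value d i k <= L ->
  place_value value d i k <= deepen_value value d i k ->
  [/\ (i < n)%N, (d <= U i)%N &
      value d i k = F i * d%:R + value d i.+1 k.-1].
Proof.
move=> d_n k0 + pq; rewrite valueE // pq; move: k0.
rewrite {}/place_value addn1 subn1 lt0n -leqn0 => /negbTE ->.
by case: ifP => [/andP []|_]; last by rewrite gerDl ler10.
Qed.

Lemma value_deepen d i k : (d <= n)%N -> (0 < k)%N -> value d i k <= L ->
  ~~ (place_value value d i k <= deepen_value value d i k) ->
  [/\ (d < n)%N, (k + k <= n - i)%N & value d i k = value d.+1 i (k + k)].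
Proof.
move=> d_n k0 + pq; rewrite valueE // (negbTE pq); move: k0.
rewrite {}/deepen_value addn1 lt0n -leqn0 => /negbTE ->.
by case: ifP => [/andP []|_]; last by rewrite gerDl ler10.
Qed.

End DynamicProgram.

Lemma eq_value (R : realFieldType) n (U U' : nat -> nat) (F : nat -> R) L d i k :
  U =1 U' -> value n U F L d i k = value n U' F L d i k.
Proof.
move=> UU'; rewrite /value; move: (n - d + (n - i))%N => t.
elim: t d i k => [|t IH] d i k.
  by rewrite /= /place_value UU'.
by rewrite /= /place_value /deepen_value UU' !IH.
Qed.

(** * Block levels and threshold vectors *)

Section Levels.
Local Open Scope ring_scope.
Variables (R : realFieldType) (s : scheme R).
Hypothesis s_valid : valid_scheme s.

Definition level_cost (h : nat) : R := \sum_(p <- take h s) p.2.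

Lemma access_costE d : access_cost s d = level_cost (block_level s d).
Proof. by []. Qed.

Lemma total_widthS h : (h < size s)%N ->
  total_width s h.+1 = (total_width s h + (nth (0%N, 0%R) s h).1)%N.
Proof.
by move=> hs; rewrite /total_width (take_nth (0%N, 0%R)) // big_rcons /= addnC.
Qed.

Lemma level_costS h : (h < size s)%N ->
  level_cost h.+1 = level_cost h + (nth (0%N, 0%R) s h).2.
Proof.
by move=> hs; rewrite /level_cost (take_nth (0%N, 0%R)) // big_rcons /= addrC.
Qed.

Lemma total_width_mono h h' : (h <= h')%N -> (total_width s h <= total_width s h')%N.
Proof.
move=> hh'; rewrite /total_width -[in X in (_ <= X)%N](subnKC hh') takeD big_cat /=.
exact: leq_addr.
Qed.

Lemma level_cost_mono h h' : (h <= h')%N -> level_cost h <= level_cost h'.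
Proof.
move=> hh'; rewrite /level_cost -(subnKC hh') takeD big_cat /= lerDl big_seq.
apply: sumr_ge0 => p /mem_take /mem_drop /s_valid [] //.
Qed.

Lemma block_level_le d h : (h <= size s)%N -> (d <= total_width s h)%N ->
  (block_level s d <= h)%N.
Proof.
move=> hs dh; rewrite leqNgt; apply/negP => /(before_find 0%N).
by rewrite nth_iota ?add0n ?dh.
Qed.

Lemma le_block_level d : (d <= total_width s (size s))%N ->
  (d <= total_width s (block_level s d))%N.
Proof.
move=> ds; have H : has (fun h => (d <= total_width s h)%N) (iota 0 (size s).+1).
  by apply/hasP; exists (size s) => //; rewrite mem_iota /= add0n.
have := nth_find 0%N H; rewrite nth_iota // -[X in (_ < X)%N](size_iota 0).
by rewrite -has_find.
Qed.

Lemma block_level_mono d d' : (d' <= total_width s (size s))%N ->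
  (d <= d')%N -> (block_level s d <= block_level s d')%N.
Proof.
move=> d's dd'; apply: block_level_le.
  exact: block_level_le (leqnn _) d's.
exact: leq_trans dd' (le_block_level d's).
Qed.

(* The thresholds [N j], [j < m], encode the nondecreasing assignments of block
   levels: at most level [j] is granted to the indices below [N j]. *)
Definition level (m : nat) (N : nat -> nat) (i : nat) : nat :=
  count (fun j => N j <= i)%N (iota 0 m).

Lemma level_le m N i : (level m N i <= m)%N.
Proof. by rewrite -[X in (_ <= X)%N](size_iota 0 m) count_size. Qed.

Lemma levelS j N i : level j.+1 N i = (level j N i + (N j <= i))%N.
Proof. by rewrite /level -[j.+1]addn1 iotaD count_cat /= addn0. Qed.

Lemma eq_level m N N' i : (forall j, (j < m)%N -> N j = N' j) ->
  level m N i = level m N' i.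
Proof. by move=> NN'; apply: eq_in_count => j; rewrite mem_iota => /NN' ->. Qed.

Definition thresholds (n : nat) (lev : nat -> nat) (j : nat) : nat :=
  find (fun i => j < lev i)%N (iota 0 n).

Lemma thresholds_le n lev j : (thresholds n lev j <= n)%N.
Proof. by rewrite -[X in (_ <= X)%N](size_iota 0 n) find_size. Qed.

(** By monotonicity of [lev], threshold j is at most i exactly when j < [lev i]; among the j < m
    there are [lev i] such indices because [lev i <= m]. *)
Lemma level_thresholds m n lev i : (i < n)%N -> (lev i <= m)%N ->
  (forall i1 i2, (i1 <= i2 < n)%N -> (lev i1 <= lev i2)%N) ->
  level m (thresholds n lev) i = lev i.
Proof.
move=> i_n lev_m lev_mono.
have E j : (thresholds n lev j <= i)%N = (j < lev i)%N.
  rewrite /thresholds; apply/idP/idP => H.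
    have hs : has (fun i0 => j < lev i0)%N (iota 0 n).
      by rewrite has_find size_iota; apply: leq_ltn_trans H i_n.
    have := nth_find 0%N hs; rewrite nth_iota /=; last first.
      by rewrite -[X in (_ < X)%N](size_iota 0 n) -has_find.
    move=> jl; apply: leq_trans jl (lev_mono _ _ _); rewrite add0n.
    by rewrite H.
  rewrite leqNgt; apply/negP => /(before_find 0%N).
  by rewrite nth_iota // add0n H.
rewrite /level (eq_count E) -(subnKC lev_m) iotaD count_cat add0n.
rewrite -[RHS]addn0; congr (_ + _)%N.
  apply/eqP; rewrite -[X in _ == X](size_iota 0 (lev i)) -all_count.
  by apply/allP => j; rewrite mem_iota.
apply/eqP; rewrite -leqn0 leqNgt -has_count; apply/hasPn => j.
by rewrite mem_iota -leqNgt => /andP [].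
Qed.

End Levels.

(** * Passing between trees and threshold vectors *)

Section Solutions.
Local Open Scope ring_scope.
Variables (R : realFieldType) (n : nat) (freq : 'I_n -> R) (s : scheme R) (L : R).
Variable sg : nat -> 'I_n.
Hypothesis freq_ge0 : forall c, 0 <= freq c.
Hypothesis s_valid : valid_scheme s.
Hypothesis sg_perm : perm_eq [seq sg i | i <- iota 0 n] (enum 'I_n).
Hypothesis sg_anti : forall i j, (i <= j)%N -> (j < n)%N -> freq (sg j) <= freq (sg i).

Lemma sum_sg (f : 'I_n -> R) :
  \sum_(c < n) f c = \sum_(0 <= i < n) f (sg i).
Proof.
by rewrite -big_enum -(perm_big _ sg_perm) big_map /index_iota subn0.
Qed.

Lemma uniq_sg i : uniq [seq sg j | j <- iota i (n - i)].
Proof.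
case: (leqP i n) => [i_n|/ltnW]; last by rewrite -subn_eq0 => /eqP ->.
have := perm_uniq sg_perm; rewrite enum_uniq.
have -> : iota 0 n = iota 0 i ++ iota i (n - i) by rewrite -iotaD subnKC.
by rewrite map_cat cat_uniq => /and3P [].
Qed.

Lemma sg_surj c : exists2 i, (i < n)%N & c = sg i.
Proof.
have : c \in [seq sg i | i <- iota 0 n] by rewrite (perm_mem sg_perm) mem_enum.
by case/mapP => i; rewrite mem_iota => i_n ->; exists i.
Qed.

Definition level_width (N : nat -> nat) (i : nat) : nat :=
  total_width s (level (size s) N i).

Definition vector_value (N : nat -> nat) : nat -> nat -> nat -> R :=
  value n (level_width N) (fun i => freq (sg i)) L.

Definition vector_time (N : nat -> nat) : R :=
  \sum_(0 <= i < n) freq (sg i) * level_cost s (level (size s) N i).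

(* [built U d i k fs l]: the forest fs has k roots at depth d, its leaves are the
   characters of rank at least i, and l is their contribution to the length. *)
Inductive built (U : nat -> nat) :
    nat -> nat -> nat -> seq (btree n) -> R -> Prop :=
  | BuiltDone d : built U d n 0 [::] 0
  | BuiltPlace d i k fs l :
      (i < n)%N -> (d <= U i)%N -> built U d i.+1 k fs l ->
      built U d i k.+1 (Leaf (sg i) :: fs) (freq (sg i) * d%:R + l)
  | BuiltDeepen d i k fs l :
      built U d.+1 i (k + k) fs l -> built U d i k (pair_up k fs) l.

Lemma built_forest U d i k fs l : built U d i k fs l ->
  [/\ (i <= n)%N, size fs = k,
      perm_eq (forest_leaves fs) [seq sg j | j <- iota i (n - i)] &
      exists delta : 'I_n -> nat,
        [/\ depths_are d delta fs,
            forall j, (i <= j < n)%N -> (delta (sg j) <= U j)%N &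
            l = \sum_(i <= j < n) freq (sg j) * (delta (sg j))%:R]].
Proof.
elim=> {d i k fs l} [d|d i k fs l i_n dU _|d i k fs l _].
- split=> //; first by rewrite subnn.
  exists (fun=> 0%N); split=> //; by rewrite big_geq.
- move=> [_ szf pl [delta [dd dU' lE]]].
  have Eiota : iota i (n - i) = i :: iota i.+1 (n - i.+1).
    by rewrite -[(n - i)%N]prednK ?subn_gt0 //= subnS.
  split=> /=; first exact: ltnW.
  + by rewrite szf.
  + by rewrite Eiota /forest_leaves /= perm_cons.
  (* The depth function is overridden at [sg i]; distinctness of the ranked characters ensures that
     the depths found for the later ranks survive. *)
  have := uniq_sg i; rewrite Eiota /= => /andP [ni _].
  have new j : (i < j < n)%N -> (sg j == sg i) = false.
    move=> ij; apply/negbTE; apply: contra ni => /eqP <-.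
    by apply: map_f; rewrite mem_iota; lia.
  exists (fun c => if c == sg i then d else delta c); split.
  + split=> [c|]; first by rewrite inE => ->; rewrite addn0.
    apply: eq_depths_are dd => c; rewrite (perm_mem pl) => cl.
    by case: eqP => // cE; move: ni; rewrite -cE cl.
  + move=> j ij; case: (ltnP i j) => [i_j|j_i]; first by rewrite new ?dU' //; lia.
    have -> : j = i by lia.
    by rewrite eqxx.
  + rewrite big_ltn // eqxx lE; congr (_ + _).
    by apply: eq_big_nat => j ij; rewrite new.
- move=> [i_n szf pl [delta [dd dU lE]]]; split=> //.
  + exact: size_pair_up.
  + by rewrite leaves_pair_up.
  + by exists delta; split=> //; apply: depths_are_pair_up.
Qed.

(** The granted level of a character may exceed the level it needs, and its cost then only dominates
    the access cost; hence an inequality between the times. *)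
Lemma built_tree N fs l : built (level_width N) 0 0 1 fs l -> l <= L ->
  exists T, [/\ fs = [:: T], feasible freq s L T &
                decode_time freq s T <= vector_time N].
Proof.
case/built_forest=> _; case: fs => [|T [|]] // _.
rewrite subn0 /forest_leaves /= cats0 => pl [delta [[dT _] dU lE]] lL.
have pT : prefix_tree T by apply: perm_trans pl sg_perm.
have dTc c : depth T c = delta c.
  by apply: dT; rewrite (perm_mem pT) mem_enum.
exists T; split=> //.
  split=> //.
    move=> c; have [i i_n ->] := sg_surj c; rewrite dTc.
    by apply: leq_trans (dU i _) (total_width_mono _ (level_le _ _ _)).
  rewrite /code_length sum_sg; apply: le_trans lL; rewrite lE.
  by apply: ler_sum => i _; rewrite dTc.
rewrite /decode_time sum_sg /vector_time.
apply: ler_sum_nat => i i_n; apply: ler_wpM2l => //.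
rewrite access_costE; apply: level_cost_mono => //.
by apply: block_level_le; rewrite ?level_le // dTc; apply: dU.
Qed.

(** Sorting the depths of [T] along the ranking increases neither objective and preserves the Kraft
    sum, which depends on the multiset of depths only. The block levels of the sorted depths are
    then monotone, so thresholds encode them exactly. *)
Lemma feasible_vector T : feasible freq s L T ->
  exists N, [/\ forall j, (N j <= n)%N, vector_value N 0 0 1 <= L &
                vector_time N <= decode_time freq s T].
Proof.
move=> [pT decT lenT].
set ds := [seq depth T (sg i) | i <- iota 0 n].
set delta := nth 0%N (insertion_sort ds).
have szd : size (insertion_sort ds) = n.
  by rewrite (perm_size (insertion_sort_perm _)) size_map size_iota.
have mem_delta i : (i < n)%N -> exists c, delta i = depth T c.
  move=> i_n; have : delta i \in insertion_sort ds by rewrite mem_nth ?szd.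
  by rewrite (perm_mem (insertion_sort_perm _)) => /mapP [j _ ->]; exists (sg j).
have delta_mono i j : (i <= j)%N -> (j < n)%N -> (delta i <= delta j)%N.
  move=> ij j_n; apply: (sorted_leq_nth leq_trans leqnn 0%N (insertion_sort_sorted ds));
    by rewrite ?inE ?szd //; apply: leq_ltn_trans j_n.
have delta_dec i : (i < n)%N -> (delta i <= total_width s (size s))%N.
  by move=> /mem_delta [c ->]; apply: decT.
have T_n c : (depth T c < n)%N.
  have cT : c \in leaves T by rewrite (perm_mem pT) mem_enum.
  by have := depth_lt_leaves cT; rewrite (perm_size pT) size_enum_ord.
pose lev i := block_level s (delta i).
have lev_mono i1 i2 : (i1 <= i2 < n)%N -> (lev i1 <= lev i2)%N.
  by move=> /andP [i12 i2n]; apply: block_level_mono; [exact: delta_dec|exact: delta_mono].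
have lev_m i : (i < n)%N -> (lev i <= size s)%N.
  by move=> i_n; apply: block_level_le (leqnn _) (delta_dec i i_n).
have levE i : (i < n)%N -> level (size s) (thresholds n lev) i = lev i.
  by move=> i_n; apply: level_thresholds (lev_m _ i_n) lev_mono.
have rearr (g : nat -> R) :
    (forall x y, (x <= y)%N -> (y <= total_width s (size s))%N -> g x <= g y) ->
    \sum_(0 <= i < n) freq (sg i) * g (delta i) <=
    \sum_(c < n) freq c * g (depth T c).
  move=> g_mono; set W := total_width s (size s) in g_mono *.
  (* Access costs are known to be monotone only up to the total width; truncation extends them to a
     monotone function without changing any depth that occurs. *)
  pose g' x := g (minn x W).
  have g'_mono x y : (x <= y)%N -> g' x <= g' y.
    by move=> xy; apply: g_mono; lia.
  have := insertion_sort_weighted_sum g'_mono (F := fun i => freq (sg i)) (xs := ds).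
  rewrite !weighted_sumE szd size_map size_iota => /(_ sg_anti).
  rewrite sum_sg; congr (_ <= _); apply: eq_big_nat => i i_n; congr (_ * _); rewrite /g'.
    by congr g; apply/minn_idPl; apply: delta_dec.
  rewrite (nth_map 0%N) ?size_iota // nth_iota // add0n.
  by congr g; apply/minn_idPl; apply: decT.
exists (thresholds n lev); split.
- exact: thresholds_le.
- apply: le_trans lenT; apply: le_trans (rearr (fun x => x%:R) _); last first.
    by move=> x y xy _; rewrite ler_nat.
  apply: value_le_depths => //.
    move=> j j_n; have [c Ec] := mem_delta j j_n; split=> //.
      by rewrite Ec; apply: ltnW.
    by rewrite /level_width levE //; apply/le_block_level/delta_dec.
  rewrite subn0 mul1n -(kraft_sum (T := T) (N := n)).
  + rewrite (perm_big _ pT) /= -(perm_big _ sg_perm) big_map.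
    transitivity (\sum_(x <- insertion_sort ds) 2 ^ (n - x))%N.
      by rewrite [RHS](big_nth 0%N) szd.
    by rewrite (perm_big _ (insertion_sort_perm ds)) big_map.
  + by rewrite (perm_uniq pT) enum_uniq.
  + by move=> c _; apply: ltnW.
- apply: le_trans (rearr (access_cost s) _); last first.
    move=> x y xy yW; rewrite !access_costE; apply: level_cost_mono => //.
    exact: block_level_mono.
  apply: ler_sum_nat => i i_n.
  by rewrite levE.
Qed.

End Solutions.

(** * Ranking by counting predecessors *)

Lemma sub_count_lt (T : eqType) (a1 a2 : pred T) (xs : seq T) x :
  subpred a1 a2 -> x \in xs -> a2 x -> ~~ a1 x ->
  (count a1 xs < count a2 xs)%N.
Proof.
move=> a12 + a2x a1x; elim: xs => //= y xs IH; rewrite inE.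
case/orP => [/eqP <-|/IH lt].
  by rewrite a2x (negbTE a1x) add0n add1n ltnS; apply: sub_count.
by have := a12 y; case: (a1 y) => [->|_] //; case: (a2 y); lia.
Qed.

Section Ranking.
Local Open Scope ring_scope.
Variables (R : realFieldType) (n : nat) (G : nat -> R).

(** The strict order by decreasing [G], ties going to the smaller index. It is phrased with [<=]
    only, so that it is literally the test in [sort_prog]. *)
Definition before (j i : nat) : bool :=
  (G i <= G j) && ~~ ((G j <= G i) && (i <= j)%N).

Definition rank (i : nat) : nat := count (fun j => before j i) (iota 0 n).

Lemma beforexx i : before i i = false.
Proof. by rewrite /before lexx leqnn. Qed.

Lemma before_trans i j k : before i j -> before j k -> before i k.
Proof.
rewrite /before => /andP [Gji nij] /andP [Gkj njk].
rewrite (le_trans Gkj Gji) /=; apply/negP => /andP [Gik ki].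
have Gij := le_trans Gik Gkj; have Gjk := le_trans Gji Gik.
move: nij njk; rewrite Gij Gjk /=; lia.
Qed.

Lemma before_total i j : i != j -> before i j || before j i.
Proof. by rewrite /before; case: (ltgtP (G i) (G j)) => //= _; lia. Qed.

Lemma rank_lt i : (i < n)%N -> (rank i < n)%N.
Proof.
move=> i_n; rewrite -[X in (_ < X)%N](size_iota 0 n) -(count_predT (iota 0 n)).
by apply: (@sub_count_lt _ _ _ _ i); rewrite ?mem_iota ?beforexx.
Qed.

Lemma before_rank i j : (i < n)%N -> before i j -> (rank i < rank j)%N.
Proof.
move=> i_n bij; apply: (@sub_count_lt _ _ _ _ i); rewrite ?mem_iota ?beforexx //.
by move=> k /before_trans; apply.
Qed.

Lemma rank_inj i j : (i < n)%N -> (j < n)%N -> rank i = rank j -> i = j.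
Proof.
move=> i_n j_n rij; apply/eqP/negP => /negP /before_total /orP [] b.
  by have := before_rank i_n b; rewrite rij ltnn.
by have := before_rank j_n b; rewrite rij ltnn.
Qed.

Lemma rank_anti i j : (j < n)%N -> (rank i <= rank j)%N -> G j <= G i.
Proof.
move=> j_n rij; case: (eqVneq i j) => [->//|/before_total /orP []].
  by case/andP.
by move/(before_rank j_n); lia.
Qed.

End Ranking.

(** [sg] inverts the rank, a permutation of the indices. The alphabet is nonempty because [sg],
    defined on all naturals, needs some character as its value beyond the alphabet. *)
Lemma ranking_exists (R : realFieldType) (n : nat) (freq : 'I_n.+1 -> R)
    (G : nat -> R) : (forall c : 'I_n.+1, G c = freq c) ->
  exists sg : nat -> 'I_n.+1,
    [/\ perm_eq [seq sg i | i <- iota 0 n.+1] (enum 'I_n.+1),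
        forall i j, (i <= j)%N -> (j < n.+1)%N -> (freq (sg j) <= freq (sg i))%R &
        forall i, (i < n.+1)%N -> rank n.+1 G (sg i) = i].
Proof.
move=> GE.
pose r (c : 'I_n.+1) : 'I_n.+1 := Ordinal (rank_lt G (ltn_ord c)).
have r_inj : injective r.
  by move=> c c' /(congr1 val) /= /rank_inj H; apply/val_inj/H.
pose sg i := invF r_inj (inord i).
have rsg i : (i < n.+1)%N -> rank n.+1 G (sg i) = i.
  move=> i_n; have /(congr1 val) /= := f_invF r_inj (inord i).
  by rewrite inordK.
exists sg; split=> //.
- apply: uniq_perm; rewrite ?enum_uniq //.
    rewrite map_inj_in_uniq ?iota_uniq // => i j.
    rewrite !mem_iota /= !add0n => i_n j_n sij.
    by rewrite -(rsg i i_n) sij rsg.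
  move=> c; rewrite mem_enum; apply/mapP; exists (val (r c)).
    by rewrite mem_iota /= add0n; apply: rank_lt.
  by rewrite /sg inord_val invF_f.
- move=> i j ij j_n; rewrite -!GE; apply: (rank_anti (n := n.+1)) => //.
  by rewrite !rsg //; apply: leq_ltn_trans j_n.
Qed.

Local Notation "P ;; Q" := (Seq P Q) (at level 60, right associativity).
Local Notation "x <- e" := (NSet x (NConst 0) e) (at level 55).
Local Notation "x <-r e" := (RSet x (NConst 0) e) (at level 55).
Local Notation real_cell x := (RGet x (NConst 0)) (only parsing).

(* Cell i of vrow holds i * (n + 1) and cell d of vlayer holds d * (n + 1)^2, which
   index the three-dimensional table without multiplication.  The counters vd' and
   vi' run upwards while the depth vd and the rank vi run downwards. *)
Local Notation vn := 0 (only parsing).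
Local Notation vm := 1 (only parsing).
Local Notation vwidth := 2 (only parsing).
Local Notation vfound := 3 (only parsing).
Local Notation vroot := 4 (only parsing).
Local Notation vord := 9 (only parsing).
Local Notation vrow := 10 (only parsing).
Local Notation vlayer := 11 (only parsing).
Local Notation vbound := 12 (only parsing).
Local Notation vvec := 13 (only parsing).
Local Notation vi := 14 (only parsing).
Local Notation vj := 15 (only parsing).
Local Notation vd := 16 (only parsing).
Local Notation vk := 17 (only parsing).
Local Notation vl := 18 (only parsing).
Local Notation va := 19 (only parsing).
Local Notation vd' := 20 (only parsing).
Local Notation vi' := 21 (only parsing).
Local Notation vx := 22 (only parsing).
Local Notation rfreq := 0 (only parsing).
Local Notation raccess := 1 (only parsing).
Local Notation rlimit := 2 (only parsing).
Local Notation rnat := 3 (only parsing).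
Local Notation rvalue := 4 (only parsing).
Local Notation rplace := 5 (only parsing).
Local Notation rdeepen := 6 (only parsing).
Local Notation rcharge := 7 (only parsing).
Local Notation rtime := 8 (only parsing).
Local Notation rbest := 9 (only parsing).

(** * The program and its correctness *)

Definition sorted_freq (e : nexp) : rexp := RGet rfreq (NGet vord e).

Definition levels_prog : prog :=
  rtime <-r RZero ;;
  For vi (cell vn)
    ((NSet vbound (cell vi) (NConst 0) ;; rcharge <-r RZero ;; vl <- NConst 0) ;;
     For vj (cell vm)
       (If (BNle (NGet vvec (cell vj)) (cell vi))
          (NSet vbound (cell vi)
             (NAdd (NGet vbound (cell vi)) (NGet vwidth (cell vl))) ;;
           rcharge <-r RAdd (real_cell rcharge) (RGet raccess (cell vl)) ;;
           vl <- NAdd (cell vl) (NConst 1))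
          Skip) ;;
     rtime <-r RAdd (real_cell rtime)
                 (RMul (sorted_freq (cell vi)) (real_cell rcharge))).

Definition table_index (d i k : nexp) : nexp :=
  NAdd (NAdd (NGet vlayer d) (NGet vrow i)) k.

(** Shared by the filling of the table and the reconstruction: decisions are not stored but
    recomputed from the values. *)
Definition choose_prog : prog :=
  (rplace <-r RAdd (real_cell rlimit) ROne ;;
   rdeepen <-r RAdd (real_cell rlimit) ROne) ;;
  If (BNle (cell vk) (NConst 0))
    (If (BNle (cell vn) (cell vi)) (rplace <-r RZero) Skip)
    (If (BAnd (BNle (NAdd (cell vi) (NConst 1)) (cell vn))
              (BNle (cell vd) (NGet vbound (cell vi))))
       (rplace <-r RAdd
          (RMul (sorted_freq (cell vi)) (RGet rnat (cell vd)))
          (RGet rvalue (table_index (cell vd) (NAdd (cell vi) (NConst 1))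
                          (NSub (cell vk) (NConst 1)))))
       Skip ;;
     If (BAnd (BNle (NAdd (cell vd) (NConst 1)) (cell vn))
              (BNle (NAdd (cell vk) (cell vk))
                    (NSub (cell vn) (cell vi))))
       (rdeepen <-r RGet rvalue
          (table_index (NAdd (cell vd) (NConst 1)) (cell vi)
             (NAdd (cell vk) (cell vk))))
       Skip).

Definition upto_n : nexp := NAdd (cell vn) (NConst 1).

(** A cell depends on the next rank at the same depth and on the next depth at the same rank, so
    both coordinates must decrease; within a row any order of [vk] would do. *)
Definition table_prog : prog :=
  For vd' upto_n (For vi' upto_n (For vk upto_n
    ((vd <- NSub (cell vn) (cell vd') ;;
      vi <- NSub (cell vn) (cell vi')) ;;
     choose_prog ;;
     If (BRle (real_cell rplace) (real_cell rdeepen))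
       (RSet rvalue (table_index (cell vd) (cell vi) (cell vk))
          (real_cell rplace))
       (RSet rvalue (table_index (cell vd) (cell vi) (cell vk))
          (real_cell rdeepen))))).

Definition place_prog : prog :=
  NSet 5 (cell va) (NConst 0) ;;
  NSet 8 (cell va) (NGet vord (cell vi)) ;;
  va <- NAdd (cell va) (NConst 1) ;;
  vi <- NAdd (cell vi) (NConst 1) ;;
  vk <- NSub (cell vk) (NConst 1).

(* Nodes are numbered breadth first: the open nodes are the vk numbers from va on,
   so their children are the 2 vk numbers that follow. *)
Definition deepen_prog : prog :=
  For vx (cell vk)
    (NSet 5 (NAdd (cell va) (cell vx)) (NConst 1) ;;
     NSet 6 (NAdd (cell va) (cell vx))
       (NAdd (NAdd (cell va) (cell vk)) (NAdd (cell vx) (cell vx))) ;;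
     NSet 7 (NAdd (cell va) (cell vx))
       (NAdd (NAdd (NAdd (cell va) (cell vk))
                   (NAdd (cell vx) (cell vx))) (NConst 1))) ;;
  va <- NAdd (cell va) (cell vk) ;;
  vk <- NAdd (cell vk) (cell vk) ;;
  vd <- NAdd (cell vd) (NConst 1).

Definition rebuild_loop : prog :=
  While (BNle (NConst 1) (cell vk))
    (choose_prog ;;
     If (BRle (real_cell rplace) (real_cell rdeepen)) place_prog deepen_prog).

Definition rebuild_prog : prog :=
  (va <- NConst 0 ;; vd <- NConst 0 ;; vi <- NConst 0 ;; vk <- NConst 1) ;;
  rebuild_loop.

(** The tree is rebuilt at each improvement, because the next vector overwrites the table. *)
Definition vector_prog : prog :=
  levels_prog ;; table_prog ;;
  If (BAnd (BRle (RGet rvalue (table_index (NConst 0) (NConst 0) (NConst 1)))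
                 (real_cell rlimit))
           (BNot (BAnd (BNle (NConst 1) (cell vfound))
                       (BRle (real_cell rbest) (real_cell rtime)))))
    ((vfound <- NConst 1 ;; rbest <-r real_cell rtime ;; vroot <- NConst 0) ;;
     rebuild_prog)
    Skip.

(** One nested loop per threshold, generated by recursion, which is why the program depends on m.
    [For] is not applicable since the counters are cells of the single array [vvec]. *)
Fixpoint enumerate_prog (j : nat) : prog :=
  if j is j'.+1 then
    NSet vvec (NConst j') (NConst 0) ;;
    While (BNle (NGet vvec (NConst j')) (cell vn))
      (enumerate_prog j' ;;
       NSet vvec (NConst j') (NAdd (NGet vvec (NConst j')) (NConst 1)))
  else vector_prog.

Definition sort_prog : prog :=
  For vi (cell vn)
    (vl <- NConst 0 ;;
     For vj (cell vn)
       (If (BAnd (BRle (RGet rfreq (cell vi)) (RGet rfreq (cell vj)))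
             (BNot (BAnd (BRle (RGet rfreq (cell vj)) (RGet rfreq (cell vi)))
                         (BNle (cell vi) (cell vj)))))
          (vl <- NAdd (cell vl) (NConst 1)) Skip) ;;
     NSet vord (cell vl) (cell vi)).

Definition multiples_prog : prog :=
  (vrow <- NConst 0 ;; vlayer <- NConst 0 ;; rnat <-r RZero) ;;
  For vi (cell vn)
    (NSet vrow (NAdd (cell vi) (NConst 1))
       (NAdd (NGet vrow (cell vi)) upto_n) ;;
     RSet rnat (NAdd (cell vi) (NConst 1)) (RAdd (RGet rnat (cell vi)) ROne)) ;;
  For vi (cell vn)
    (NSet vlayer (NAdd (cell vi) (NConst 1))
       (NAdd (NGet vlayer (cell vi)) (NAdd (NGet vrow (cell vn)) upto_n))).

Definition dopt_prog (m : nat) : prog :=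
  sort_prog ;; multiples_prog ;; enumerate_prog m.

(** * Step counts *)

Definition levels_cost (n m : nat) : nat :=
  3 + for_cost (cell vn) n (20 + (for_cost (cell vm) m 40 + 20)).

Definition table_cost (n : nat) : nat :=
  for_cost upto_n n.+1 (for_cost upto_n n.+1
    (for_cost upto_n n.+1 (20 + (150 + 40)))).

Definition rebuild_step_cost (n : nat) : nat :=
  180 + (for_cost (cell vk) n 60 + 40).

(** A reconstruction makes at most n placements and n deepenings; the additional unit in
    [(n + n).+1] pays for leaving the loop. *)
Definition vector_cost (n m : nat) : nat :=
  levels_cost n m + (table_cost n +
    (60 + (20 + (n + n).+1 * rebuild_step_cost n))).

Fixpoint enumerate_cost (n m j : nat) : nat :=
  if j is j'.+1 then 10 + n.+2 * (enumerate_cost n m j' + 20)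
  else vector_cost n m.

Definition dopt_cost (n m : nat) : nat :=
  for_cost (cell vn) n (5 + (for_cost (cell vn) n 60 + 10)) +
  (20 + (for_cost (cell vn) n 60 + for_cost (cell vn) n 60) +
   enumerate_cost n m m).

Lemma dopt_cost_bounded m : poly_bounded (3 + m) (dopt_cost^~ m).
Proof.
have Hn n : n <= 1 * n.+1 by rewrite mul1n.
have HSn n : n.+1 <= 1 * n.+1 by rewrite mul1n.
have sort_bd : poly_bounded 2 (fun n =>
    for_cost (cell vn) n (5 + (for_cost (cell vn) n 60 + 10))).
  apply: (poly_bounded_for _ Hn); apply: poly_boundedD (poly_bounded_const _ _) _.
  apply: poly_boundedD (poly_bounded_for _ Hn _) (poly_bounded_const _ _).
  exact: (poly_bounded_const 0).
have mult_bd : poly_bounded 1 (fun n =>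
    20 + (for_cost (cell vn) n 60 + for_cost (cell vn) n 60)).
  apply: poly_boundedD (poly_bounded_const _ _) _.
  by apply: poly_boundedD; apply: (poly_bounded_for _ Hn (poly_bounded_const 0 _)).
have levels_bd : poly_bounded 1 (levels_cost^~ m).
  apply: poly_boundedD (poly_bounded_const _ _) _.
  exact: (poly_bounded_for _ Hn (poly_bounded_const 0 _)).
have table_bd : poly_bounded 3 table_cost.
  do 3!apply: (poly_bounded_for _ HSn); exact: (poly_bounded_const 0).
have step_bd : poly_bounded 1 rebuild_step_cost.
  apply: poly_boundedD (poly_bounded_const _ _) _.
  apply: poly_boundedD (poly_bounded_for _ Hn _) (poly_bounded_const _ _).
  exact: (poly_bounded_const 0).
have vector_bd : poly_bounded 3 (vector_cost^~ m).
  apply: poly_boundedD; first exact: poly_bounded_le levels_bd.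
  apply: poly_boundedD => //; do 2!apply: poly_boundedD (poly_bounded_const _ _) _.
  apply: poly_bounded_le (poly_boundedM (k1 := 1) _ step_bd) => //.
  by apply: (@poly_bounded_linear 2) => n; lia.
have enum_bd j : poly_bounded (3 + j) (fun n => enumerate_cost n m j).
  elim: j => [|j IH] //=; apply: poly_boundedD (poly_bounded_const _ _) _.
  rewrite addnS; apply: (poly_boundedM (k1 := 1)).
    by apply: (@poly_bounded_linear 2) => n; lia.
  exact: poly_boundedD (poly_bounded_const _ _).
apply: poly_boundedD; first by apply: poly_bounded_le sort_bd.
by apply: poly_boundedD; first by apply: poly_bounded_le mult_bd.
Qed.

(** * Specifications of the program fragments *)

Section Correctness.
Variables (R : realFieldType) (n : nat) (freq : 'I_n -> R) (s : scheme R) (L : R).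
Variables (G : nat -> R) (sg : nat -> 'I_n).
Hypothesis G_freq : forall c : 'I_n, G c = freq c.
Implicit Types M : memory R.

(** The input and the precomputed arrays, which the enumeration never writes; [tables_frame] carries
    them along by computation. *)
Record tables M : Prop := Tables {
  tables_n : nmem M vn 0 = n;
  tables_m : nmem M vm 0 = size s;
  tables_width : forall i, nmem M vwidth i = (nth (0, 0%R) s i).1;
  tables_freq : forall i, rmem M rfreq i = G i;
  tables_access : forall i, rmem M raccess i = (nth (0, 0%R) s i).2;
  tables_limit : rmem M rlimit 0 = L;
  tables_ord : forall i, i < n -> nmem M vord i = sg i;
  tables_row : forall i, i <= n -> nmem M vrow i = i * n.+1;
  tables_layer : forall d, d <= n -> nmem M vlayer d = d * (n.+1 * n.+1);
  tables_nat : forall d, d <= n -> rmem M rnat d = (d%:R)%R }.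

Lemma tables_frame P M M' :
  frame P M M' -> tables M ->
  all (fun a => a \notin nat_writes P) [:: vn; vm; vwidth; vord; vrow; vlayer] ->
  all (fun a => a \notin real_writes P) [:: rfreq; raccess; rlimit; rnat] ->
  tables M'.
Proof.
move=> [fn fr] t /=.
move=> /and5P [n1 n2 n3 n4 /and3P [n5 n6 _]] /and5P [r1 r2 r3 r4 _].
by split=> *; rewrite ?fn ?fr // ?(tables_n t) ?(tables_m t) ?(tables_width t)
   ?(tables_freq t) ?(tables_access t) ?(tables_limit t) ?(tables_ord t)
   ?(tables_row t) ?(tables_layer t) ?(tables_nat t).
Qed.

(** [vl] counts the thresholds passed so far and is also the index of the next block to add. Being a
    count, it treats unsorted vectors correctly too. *)
Lemma levels_wp M : tables M ->
  wp levels_prog M (levels_cost n (size s)) (fun M' =>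
    (forall i, i < n -> nmem M' vbound i = level_width s (nmem M vvec) i) /\
    rmem M' rtime 0 = vector_time freq s sg (nmem M vvec)).
Proof.
move=> tM; rewrite /levels_cost /levels_prog.
set N := nmem M vvec.
apply: wp_seq; apply: wp_step_frame => // M0 M0E f0.
have tM0 : tables M0 := tables_frame f0 tM isT isT.
have M0N j : nmem M0 vvec j = N j by rewrite f0.1.
pose I i (M' : memory R) :=
  (forall i', i' < i -> nmem M' vbound i' = level_width s N i') /\
  (rmem M' rtime 0 = \sum_(0 <= i' < i) freq (sg i') * level_cost s (level (size s) N i'))%R.
apply: wp_weaken (wp_for (k := n) (I := I) _ _ _ _) (leqnn _) _ => //.
- by move=> j M1 _ f; rewrite /= (tables_n (tables_frame f tM0 isT isT)).
- by rewrite M0E; split=> //=; rewrite big_geq.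
- move=> i M1 i_n M1i f1 [I1 I2].
  have tM1 : tables M1 := tables_frame f1 tM0 isT isT.
  have M1N j : nmem M1 vvec j = N j by rewrite f1.1.
  apply: wp_seq; apply: wp_step_frame => // M2 M2E f2.
  have tM2 : tables M2 := tables_frame f2 tM1 isT isT.
  pose J j (M' : memory R) :=
    [/\ nmem M' vl 0 = level j N i,
        nmem M' vbound i = total_width s (level j N i),
        rmem M' rcharge 0 = level_cost s (level j N i) &
        forall i', i' < i -> nmem M' vbound i' = level_width s N i'].
  apply: wp_seq_mid (wp_for (k := size s) (T := 40) (I := J) _ _ _ _) _ => //.
  + by move=> j M3 _ f; rewrite /= (tables_m (tables_frame f tM2 isT isT)).
  + rewrite M2E; split=> //=; rewrite /update /= ?M1i ?eqxx //.
    * by rewrite /total_width /level /= take0 big_nil.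
    * by rewrite /level_cost /level /= take0 big_nil.
    * by move=> i' i'i; rewrite ltn_eqF // I1.
  + move=> j M3 j_m M3j f3 [J1 J2 J3 J4].
    have tM3 : tables M3 := tables_frame f3 tM2 isT isT.
    have M3i : nmem M3 vi 0 = i by rewrite f3.1 // f2.1.
    have M3N : nmem M3 vvec j = N j by rewrite f3.1 // f2.1.
    have lj : level j N i < size s by apply: leq_ltn_trans (level_le _ _ _) j_m.
    apply: wp_step => //=; rewrite M3j M3i M3N; case: ifP => Nj.
      split=> /=; rewrite /update /= ?eqxx ?M3i ?J1 ?J2 ?J3 ?levelS ?Nj ?addn1 //.
      * by rewrite (tables_width tM3) total_widthS.
      * by rewrite (tables_access tM3) level_costS.
      * by move=> i' i'i; rewrite ltn_eqF // J4.
    by split=> //=; rewrite /update /= ?J1 ?J2 ?J3 ?levelS ?Nj ?addn0.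
  + move=> M3 f3 [[J1 J2 J3 J4] _ _].
    have tM3 : tables M3 := tables_frame f3 tM2 isT isT.
    have M3i : nmem M3 vi 0 = i by rewrite f3.1 // f2.1.
    apply: wp_step => //=; rewrite M3i J3; split=> /=.
      move=> i'; rewrite ltnS leq_eqVlt => /orP [/eqP ->|] //; exact: J4.
    rewrite /update /= big_nat_recr //= f3.2 // f2.2 // I2; congr (_ + _)%R.
    by rewrite (tables_freq tM3) (tables_ord tM3) // G_freq.
- by move=> M' _ [[I1 I2] _ _].
Qed.

Definition cell_index (d i k : nat) : nat := d * (n.+1 * n.+1) + i * n.+1 + k.

(** Uniqueness of digits in base n + 1. *)
Lemma cell_index_inj d i k d' i' k' :
  i <= n -> k <= n -> i' <= n -> k' <= n ->
  cell_index d i k = cell_index d' i' k' -> [/\ d = d', i = i' & k = k'].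
Proof.
have split_digit a b a' b' : b <= n -> b' <= n ->
    a * n.+1 + b = a' * n.+1 + b' -> a = a' /\ b = b'.
  move=> bn b'n E; have Ea : a = a'.
    by have := congr1 (divn^~ n.+1) E; rewrite /= !divnMDl // !divn_small // !addn0.
  by split=> //; move: E; rewrite Ea => /addnI.
move=> i_n k_n i'n k'n; rewrite /cell_index !mulnA -!mulnDl.
by case/split_digit => // /split_digit [] // -> -> ->.
Qed.

Definition stored_value M (d i k : nat) : R := rmem M rvalue (cell_index d i k).

Definition bounds_stored (U : nat -> nat) M : Prop :=
  forall i, i < n -> nmem M vbound i = U i.

Lemma choose_wp U M d i k : tables M -> bounds_stored U M ->
  nmem M vd 0 = d -> nmem M vi 0 = i -> nmem M vk 0 = k ->
  d <= n -> i <= n -> k <= n ->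
  wp choose_prog M 150 (fun M' =>
    rmem M' rplace 0 =
      place_value n U (fun j => freq (sg j)) L (stored_value M) d i k /\
    rmem M' rdeepen 0 = deepen_value n L (stored_value M) d i k).
Proof.
move=> tM bM Md Mi Mk d_n i_n k_n.
(* The two initial assignments cost 6 each and the test on [vk] costs 4, plus 1 for branching; 133
   is left for the branches. *)
rewrite (_ : 150 = 12 + (4 + 133).+1) //; apply: wp_seq.
apply: wp_step_frame => // M1 M1E f1.
have tM1 := tables_frame f1 tM isT isT.
have M1p : rmem M1 rplace 0 = (L + 1)%R by rewrite M1E /= /update /= (tables_limit tM).
have M1d : rmem M1 rdeepen 0 = (L + 1)%R by rewrite M1E /= /update /= (tables_limit tM).
rewrite -(f1.1 vd) // in Md; rewrite -(f1.1 vi) // in Mi; rewrite -(f1.1 vk) // in Mk.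
have {}bM j : j < n -> nmem M1 vbound j = U j by move=> j_n; rewrite f1.1 // bM.
have <- : stored_value M1 = stored_value M by rewrite /stored_value M1E.
clear M1E f1 tM M.
apply: wp_if => /=; rewrite Mk.
rewrite /place_value /deepen_value.
case: ifP => [_|k0].
  by apply: wp_step => //=; rewrite (tables_n tM1) Mi; case: ifP.
rewrite (_ : 133 = 50 + 83) //.
set place := (if (i + 1 <= n) && _ then _ else _).
apply: (wp_seq_mid (Q1 := fun M2 => rmem M2 rplace 0 = place)).
  rewrite /place; apply: wp_step => //=; rewrite (tables_n tM1) Mi Md.
  have -> : (i + 1 <= n) && (d <= nmem M1 vbound i) = (i + 1 <= n) && (d <= U i).
    by case: (boolP (i + 1 <= n)) => //= ?; rewrite bM // -addn1.
  case: ifP => [/andP [i_lt dU]|_]; last exact: M1p.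
  have i_n' : i < n by rewrite -addn1.
  have Ff : rmem M1 rfreq (nmem M1 vord i) = freq (sg i).
    by rewrite (tables_ord tM1) // (tables_freq tM1).
  rewrite /= /update /= ?Mi ?Md ?Mk Ff (tables_nat tM1) //.
  by rewrite (tables_layer tM1) // (tables_row tM1).
move=> M2 f2 M2p; have tM2 := tables_frame f2 tM1 isT isT.
rewrite -(f2.1 vd) // in Md; rewrite -(f2.1 vi) // in Mi; rewrite -(f2.1 vk) // in Mk.
rewrite -(f2.2 rdeepen) // in M1d.
apply: wp_step => //=; rewrite (tables_n tM2) Mi Md Mk.
case: ifP => [/andP [d_lt kk]|_]; last by split.
split; first exact: M2p.
rewrite /= /update /= ?Mi ?Md ?Mk (tables_layer tM2) // (tables_row tM2) //.
by rewrite f2.2.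
Qed.

Lemma table_wp U M : tables M -> bounds_stored U M ->
  wp table_prog M (table_cost n) (fun M' =>
    forall d i k, d <= n -> i <= n -> k <= n ->
      stored_value M' d i k = value n U (fun j => freq (sg j)) L d i k).
Proof.
move=> tM bM; set V := value n U _ L; rewrite /table_cost.
have upto M1 : tables M1 -> neval M1 upto_n = n.+1.
  by move=> t1; rewrite /= (tables_n t1) addn1.
(* Nested invariants: all deeper layers are filled; moreover the larger ranks of the current layer;
   moreover an initial segment of the current row. *)
pose I1 a M1 := forall d i k, d <= n -> i <= n -> k <= n -> n < d + a ->
  stored_value M1 d i k = V d i k.
pose I2 a b M1 := I1 a M1 /\ forall i k, i <= n -> k <= n -> n < i + b ->
  stored_value M1 (n - a) i k = V (n - a) i k.
pose I3 a b c M1 := I2 a b M1 /\ forall k, k < c ->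
  stored_value M1 (n - a) (n - b) k = V (n - a) (n - b) k.
apply: wp_weaken (wp_for (k := n.+1) (I := I1) _ _ _ _) (leqnn _) _ => //.
- by move=> j M1 _ f; apply: upto (tables_frame f tM isT isT).
- by move=> d i k; lia.
- move=> a M1 a_n M1a f1 I1M1.
  have tM1 := tables_frame f1 tM isT isT.
  have bM1 : bounds_stored U M1 by move=> i i_n; rewrite f1.1 // bM.
  apply: wp_weaken (wp_for (k := n.+1) (I := I2 a) _ _ _ _) (leqnn _) _ => //.
  + by move=> j M2 _ f; apply: upto (tables_frame f tM1 isT isT).
  + by split=> // i k; lia.
  + move=> b M2 b_n M2b f2 I2M2.
    have tM2 := tables_frame f2 tM1 isT isT.
    have bM2 : bounds_stored U M2 by move=> i i_n; rewrite f2.1 // bM1.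
    have M2a : nmem M2 vd' 0 = a by rewrite f2.1.
    apply: wp_weaken (wp_for (k := n.+1) (I := I3 a b) _ _ _ _) (leqnn _) _ => //.
    * by move=> j M3 _ f; apply: upto (tables_frame f tM2 isT isT).
    * move=> k M3 k_n M3k f3 I3M3.
      have tM3 := tables_frame f3 tM2 isT isT.
      have M3a : nmem M3 vd' 0 = a by rewrite f3.1.
      have M3b : nmem M3 vi' 0 = b by rewrite f3.1.
      apply: wp_seq; apply: wp_step_frame => // M4 M4E f4.
      have tM4 := tables_frame f4 tM3 isT isT.
      have bM4 : bounds_stored U M4 by move=> i i_n; rewrite f4.1 // f3.1 // bM2.
      have M4d : nmem M4 vd 0 = n - a by rewrite M4E /= /update /= (tables_n tM3) M3a.
      have M4i : nmem M4 vi 0 = n - b by rewrite M4E /= /update /= (tables_n tM3) M3b.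
      have M4k : nmem M4 vk 0 = k by rewrite f4.1.
      have v4 : stored_value M4 = stored_value M3 by rewrite /stored_value M4E.
      apply: wp_seq_mid (choose_wp tM4 bM4 M4d M4i M4k _ _ _) _; try lia.
      move=> M5 f5 [M5p M5d].
      have tM5 := tables_frame f5 tM4 isT isT.
      have {}M4d : nmem M5 vd 0 = n - a by rewrite f5.1.
      have {}M4i : nmem M5 vi 0 = n - b by rewrite f5.1.
      have {}M4k : nmem M5 vk 0 = k by rewrite f5.1.
      have v5 d' i' k' : stored_value M5 d' i' k' = stored_value M3 d' i' k'.
        by rewrite -v4 /stored_value f5.2.
      case: I3M3 => [[I1M3 I2M3] I3M3].
      have Ep : rmem M5 rplace 0 = place_value n U (fun j => freq (sg j)) L V (n - a) (n - b) k.
        by rewrite M5p v4; apply: place_value_ext => ?; apply: I2M3; lia.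
      have Ed : rmem M5 rdeepen 0 = deepen_value n L V (n - a) (n - b) k.
        by rewrite M5d v4; apply: deepen_value_ext => ? ? ?; apply: I1M3; lia.
      (* Both branches write the minimum of the two candidates, so one memory describes either
         outcome. *)
      pose M6 := Memory (nmem M5) (update (rmem M5) rvalue (cell_index (n - a) (n - b) k)
                                    (V (n - a) (n - b) k)).
      suff H : I3 a b k.+1 M6.
        apply: wp_step => //=; rewrite M4d M4i M4k.
        rewrite (tables_layer tM5) ?leq_subr // (tables_row tM5) ?leq_subr //.
        by move: H; rewrite /M6 /V valueE ?leq_subr // -/V -Ep -Ed; case: ifP.
      have v6 d' i' k' : i' <= n -> k' <= n -> stored_value M6 d' i' k' =
          if [&& d' == n - a, i' == n - b & k' == k] then V (n - a) (n - b) k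
          else stored_value M3 d' i' k'.
        move=> i'n k'n; rewrite -v5 /stored_value /M6 /= /update /=.
        case: eqP => [E|nE].
          have [-> -> ->] : [/\ d' = n - a, i' = n - b & k' = k].
            by apply: cell_index_inj E; lia.
          by rewrite !eqxx.
        by case: and3P => // [[/eqP d'E /eqP i'E /eqP k'E]]; rewrite d'E i'E k'E in nE.
      have v6V d' i' k' : i' <= n -> k' <= n ->
          (stored_value M3 d' i' k' = V d' i' k') -> stored_value M6 d' i' k' = V d' i' k'.
        by move=> i'n k'n E; rewrite v6 //; case: and3P => // [[/eqP -> /eqP -> /eqP ->]].
      split; [split|].
      -- by move=> d' i' k' d'n i'n k'n lt; apply: v6V => //; apply: I1M3.
      -- by move=> i' k' i'n k'n lt; apply: v6V => //; apply: I2M3.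
      -- move=> k' k'k; case: (ltnP k' k) => [lt|ge].
           by apply: v6V; rewrite ?I3M3 //; lia.
         have -> : k' = k by lia.
         by rewrite v6 ?eqxx //; lia.
    * move=> M3 _ [[[I1M3 I2M3] I3M3] _ _]; split=> // i k i_n k_n lt.
      case: (ltnP n (i + b)) => [lt'|ge]; first exact: I2M3.
      have -> : i = n - b by lia.
      exact: I3M3.
  + move=> M2 _ [[I1M2 I2M2] _ _] d i k d_n i_n k_n lt.
    case: (ltnP n (d + a)) => [lt'|ge]; first exact: I1M2.
    have -> : d = n - a by lia.
    by apply: I2M2 => //; lia.
- by move=> M' _ [I1M' _ _] d i k d_n i_n k_n; apply: I1M' => //; lia.
Qed.

Fixpoint stored_forest M (a : nat) (fs : seq (btree n)) : Prop :=
  if fs is T :: fs' then stored_tree M a T /\ stored_forest M a.+1 fs' else True.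

Lemma stored_pair_up M a b k fs :
  (forall x, x < k -> [/\ nmem M 5 (a + x) = 1, nmem M 6 (a + x) = b + (x + x) &
                          nmem M 7 (a + x) = b + (x + x) + 1]) ->
  stored_forest M b fs -> stored_forest M a (pair_up k fs).
Proof.
elim: k a b fs => [|k IH] a b [|T1 [|T2 fs]] //= Mk [sT1 [sT2 sfs]].
have [M5 M6 M7] := Mk 0 isT; rewrite !addn0 in M5 M6 M7.
split; first by rewrite M5 M6 M7 addn1.
apply: (IH a.+1 b.+2) sfs => x xk; have [] := Mk x.+1 xk.
by rewrite !addSnnS !addnS !addSn => -> -> ->.
Qed.

(** Nodes numbered below [va] are final. This makes a node written now still readable after the rest
    of the reconstruction. *)
Definition same_nodes_below (a : nat) M M' : Prop :=
  forall x, x < a -> [/\ nmem M' 5 x = nmem M 5 x, nmem M' 6 x = nmem M 6 x,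
                         nmem M' 7 x = nmem M 7 x & nmem M' 8 x = nmem M 8 x].

Lemma deepen_wp M a k d : k <= n ->
  nmem M va 0 = a -> nmem M vk 0 = k -> nmem M vd 0 = d ->
  wp deepen_prog M (for_cost (cell vk) n 60 + 30) (fun M' =>
    [/\ forall x, x < k -> [/\ nmem M' 5 (a + x) = 1,
             nmem M' 6 (a + x) = a + k + (x + x) &
             nmem M' 7 (a + x) = a + k + (x + x) + 1],
        same_nodes_below a M M' &
        [/\ nmem M' va 0 = a + k, nmem M' vk 0 = k + k & nmem M' vd 0 = d + 1]]).
Proof.
move=> k_n Ma Mk Md.
pose I j M1 := (forall x, x < j -> [/\ nmem M1 5 (a + x) = 1,
             nmem M1 6 (a + x) = a + k + (x + x) &
             nmem M1 7 (a + x) = a + k + (x + x) + 1]) /\ same_nodes_below a M M1.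
suff H : wp deepen_prog M (for_cost (cell vk) k 60 + 30) (fun M' =>
    I k M' /\
    [/\ nmem M' va 0 = a + k, nmem M' vk 0 = k + k & nmem M' vd 0 = d + 1]).
  apply: wp_weaken H _ _; first by rewrite leq_add2r leq_mul2r ltnS k_n orbT.
  by move=> M' _ [[]].
apply: wp_seq_mid (wp_for (k := k) (T := 60) (I := I) _ _ _ _) _ => //.
- by move=> j M1 _ f; rewrite /= f.1.
- move=> j M1 jk M1j f [I1 I2].
  have M1a : nmem M1 va 0 = a by rewrite f.1.
  have M1k : nmem M1 vk 0 = k by rewrite f.1.
  apply: wp_step => //=; split=> x xj; rewrite /= /update /= ?M1a ?M1k ?M1j.
    rewrite eqn_add2l; case: (eqVneq x j) => [->//|xnj]; apply: I1; lia.
  have -> : (x == a + j) = false by lia.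
  exact: I2.
- move=> M1 f [IM1 _ _].
  have M1a : nmem M1 va 0 = a by rewrite f.1.
  have M1k : nmem M1 vk 0 = k by rewrite f.1.
  have M1d : nmem M1 vd 0 = d by rewrite f.1.
  by apply: wp_step => //=; split; rewrite /= /update /= ?M1a ?M1k ?M1d.
Qed.

Lemma place_wp M a i k : i < n -> tables M ->
  nmem M va 0 = a -> nmem M vk 0 = k -> nmem M vi 0 = i ->
  wp place_prog M 40 (fun M' =>
    [/\ nmem M' 5 a = 0 /\ nmem M' 8 a = sg i,
        same_nodes_below a M M' &
        [/\ nmem M' va 0 = a + 1, nmem M' vk 0 = k - 1 & nmem M' vi 0 = i + 1]]).
Proof.
move=> i_n tM Ma Mk Mi; apply: wp_step => //=; split; rewrite /= /update /= ?Ma ?Mk ?Mi //.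
  by rewrite !eqxx (tables_ord tM).
by move=> x xa /=; rewrite ltn_eqF.
Qed.

(** Induction on the remaining steps. The invariant that the value is at most [L] persists: placing
    removes a nonnegative term, by nonnegativity of the frequencies, and deepening keeps the value.
    So no dead end is met, and the forest is assembled from the one returned by the later steps. *)
Lemma rebuild_loop_wp U t M d i k a :
  (forall c, 0 <= freq c)%R -> n - d + (n - i) < t ->
  let V := value n U (fun j => freq (sg j)) L in
  tables M -> bounds_stored U M ->
  (forall d i k, d <= n -> i <= n -> k <= n -> stored_value M d i k = V d i k) ->
  nmem M vd 0 = d -> nmem M vi 0 = i -> nmem M vk 0 = k -> nmem M va 0 = a ->
  d <= n -> i <= n -> k <= n -> (V d i k <= L)%R ->
  wp rebuild_loop M (t * (rebuild_step_cost n)) (fun M' =>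
    same_nodes_below a M M' /\
    exists2 fs, built freq sg U d i k fs (V d i k) & stored_forest M' a fs).
Proof.
move=> freq_ge0 + V.
elim: t M d i k a => [|t IH] M d i k a // tle tM bM vM Md Mi Mk Ma d_n i_n k_n VL.
have [k0|k_gt0] := posnP k.
  have [iE VE] : i = n /\ V d i 0 = 0%R by apply: value_done => //; rewrite -k0.
  have loop_false : ~~ beval M (BNle (NConst 1) (cell vk)) by rewrite /= Mk k0.
  apply: (wp_weaken (wp_while_false (Q := eq M) _ loop_false erefl)).
    by rewrite mulSn /rebuild_step_cost /=; lia.
  move=> M' _ <-; split=> //; exists [::] => //.
  by rewrite k0 VE iE; apply: BuiltDone.
have loop_true : beval M (BNle (NConst 1) (cell vk)) by rewrite /= Mk.
apply: wp_weaken (wp_while_true loop_true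
  (T1 := 150 + (5 + (for_cost (cell vk) n 60 + 40)).+1)
  (T2 := t * (rebuild_step_cost n)) _) _ (fun M' _ H => H); last first.
  by rewrite mulSn {2}/rebuild_step_cost /=; lia.
apply: wp_seq_mid (choose_wp tM bM Md Mi Mk d_n i_n k_n) _ => M1 f1 [M1p M1d].
have tM1 := tables_frame f1 tM isT isT.
have {}Md : nmem M1 vd 0 = d by rewrite f1.1.
have {}Mi : nmem M1 vi 0 = i by rewrite f1.1.
have {}Mk : nmem M1 vk 0 = k by rewrite f1.1.
have {}Ma : nmem M1 va 0 = a by rewrite f1.1.
have n1 M' : same_nodes_below a M1 M' -> same_nodes_below a M M'.
  by move=> H x xa; have [-> -> -> ->] := H x xa; rewrite !f1.1.
have Ep : rmem M1 rplace 0 = place_value n U (fun j => freq (sg j)) L V d i k.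
  by rewrite M1p; apply: place_value_ext => ?; apply: vM; lia.
have Ed : rmem M1 rdeepen 0 = deepen_value n L V d i k.
  by rewrite M1d; apply: deepen_value_ext => ? ? ?; apply: vM; lia.
have {}bM : bounds_stored U M1 by move=> j j_n; rewrite f1.1 // bM.
have {}vM d' i' k' : d' <= n -> i' <= n -> k' <= n -> stored_value M1 d' i' k' = V d' i' k'.
  by move=> *; rewrite -vM // /stored_value f1.2.
apply: wp_if => /=; rewrite Ep Ed; case: ifP => [pq|/negbT pq].
  have [i_lt dU VE] := value_place d_n k_gt0 VL pq; rewrite -/V in VE.
  have VL' : (V d i.+1 k.-1 <= L)%R.
    by apply: le_trans VL; rewrite VE lerDr mulr_ge0.
  apply: wp_weaken (place_wp i_lt tM1 Ma Mk Mi) _ _; first by lia.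
  move=> M2 f2 [[M2a5 M2a8] low2 [M2a M2k M2i]].
  have tM2 := tables_frame f2 tM1 isT isT.
  have M2d : nmem M2 vd 0 = d by rewrite f2.1.
  rewrite ?addn1 ?subn1 in M2a M2k M2i.
  have bM2 : bounds_stored U M2 by move=> j j_n; rewrite f2.1 // bM.
  have vM2 d' i' k' : d' <= n -> i' <= n -> k' <= n -> stored_value M2 d' i' k' = V d' i' k'.
    by move=> *; rewrite -vM // /stored_value f2.2.
  apply: wp_weaken (IH _ _ _ _ _ _ tM2 bM2 vM2 M2d M2i M2k M2a d_n i_lt _ VL') _ _
    => //; try lia.
  move=> M3 _ [low3 [fs bfs sfs]]; split.
    apply: n1 => x xa; have [-> -> -> ->] := low3 x (ltnW xa); exact: low2.
  exists (Leaf (sg i) :: fs).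
    by rewrite VE -(prednK k_gt0); apply: BuiltPlace.
  by split=> //=; have [-> _ _ ->] := low3 a (leqnn _).
have [d_lt kk VE] := value_deepen d_n k_gt0 VL pq; rewrite -/V in VE.
rewrite VE in VL.
apply: wp_weaken (deepen_wp k_n Ma Mk Md) _ _; first by lia.
move=> M2 f2 [nodes2 low2 [M2a M2k M2d]].
have tM2 := tables_frame f2 tM1 isT isT.
have M2i : nmem M2 vi 0 = i by rewrite f2.1.
rewrite addn1 in M2d.
have bM2 : bounds_stored U M2 by move=> j j_n; rewrite f2.1 // bM.
have vM2 d' i' k' : d' <= n -> i' <= n -> k' <= n -> stored_value M2 d' i' k' = V d' i' k'.
  by move=> *; rewrite -vM // /stored_value f2.2.
apply: wp_weaken (IH _ _ _ _ _ _ tM2 bM2 vM2 M2d M2i M2k M2a d_lt i_n _ VL) _ _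
  => //; try lia.
move=> M3 _ [low3 [fs bfs sfs]]; split.
  apply: n1 => x xa; have x_lt : x < a + k by lia.
  by have [-> -> -> ->] := low3 x x_lt; exact: low2.
exists (pair_up k fs); first by rewrite VE; apply: BuiltDeepen.
apply: stored_pair_up sfs => x xk; have x_lt : a + x < a + k by rewrite ltn_add2l.
by have [-> -> -> _] := low3 _ x_lt; apply: nodes2.
Qed.

Lemma rebuild_wp U M :
  0 < n -> (forall c, 0 <= freq c)%R ->
  let V := value n U (fun j => freq (sg j)) L in
  tables M -> bounds_stored U M ->
  (forall d i k, d <= n -> i <= n -> k <= n -> stored_value M d i k = V d i k) ->
  (V 0 0 1 <= L)%R ->
  wp rebuild_prog M (20 + (n + n).+1 * (rebuild_step_cost n)) (fun M' =>
    exists2 fs, built freq sg U 0 0 1 fs (V 0 0 1) & stored_forest M' 0 fs).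
Proof.
move=> n_gt0 freq_ge0 V tM bM vM VL.
apply: wp_seq; apply: wp_step_frame => // M1 M1E f1.
have tM1 := tables_frame f1 tM isT isT.
have bM1 : bounds_stored U M1 by move=> j j_n; rewrite f1.1 // bM.
have vM1 d' i' k' : d' <= n -> i' <= n -> k' <= n -> stored_value M1 d' i' k' = V d' i' k'.
  by move=> *; rewrite -vM // /stored_value f1.2.
apply: wp_weaken (rebuild_loop_wp (d := 0) (i := 0) (k := 1) (a := 0)
  freq_ge0 _ tM1 bM1 vM1 _ _ _ _ _ _ _ VL) (leqnn _) _; rewrite ?subn0 ?M1E //.
by move=> M' _ [].
Qed.

Lemma stored_tree_ext M M' x (T : btree n) :
  (forall y, [/\ nmem M' 5 y = nmem M 5 y, nmem M' 6 y = nmem M 6 y,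
                 nmem M' 7 y = nmem M 7 y & nmem M' 8 y = nmem M 8 y]) ->
  stored_tree M x T -> stored_tree M' x T.
Proof.
move=> E; elim: T x => [c|l IHl r IHr] x /=; have [E5 E6 E7 E8] := E x.
  by rewrite E5 E8.
by rewrite E5 E6 E7 => -[-> /IHl ? /IHr ?].
Qed.

(** [rbest] is a vector time, hence only an upper bound for the decode time of the stored tree, but
    a lower bound for all admissible vectors in [S]; optimality needs just this sandwich. *)
Definition best_so_far (S : (nat -> nat) -> Prop) M : Prop :=
  (nmem M vfound 0 = 0 /\
     forall N, S N -> ~ (vector_value freq s L sg N 0 0 1 <= L)%R) \/
  (nmem M vfound 0 = 1 /\
     exists T, [/\ stored_tree M (nmem M vroot 0) T, feasible freq s L T,
       (decode_time freq s T <= rmem M rbest 0)%R &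
       forall N, S N -> (vector_value freq s L sg N 0 0 1 <= L)%R ->
         (rmem M rbest 0 <= vector_time freq s sg N)%R]).

Lemma best_so_far_frame P M M' S :
  frame P M M' -> best_so_far S M ->
  all (fun a => a \notin nat_writes P) [:: vfound; vroot; 5; 6; 7; 8] ->
  rbest \notin real_writes P -> best_so_far S M'.
Proof.
move=> [fn fr] + /= /and5P [n1 n2 n3 n4 /and3P [n5 n6 _]] r1.
case=> [[M3 H]|[M3 [T [sT fT tT H]]]]; [left|right]; rewrite fn //; split=> //.
exists T; rewrite !fn // !fr //; split=> //.
by apply: stored_tree_ext sT => y; rewrite !fn.
Qed.

Lemma best_so_far_sub (S S' : (nat -> nat) -> Prop) M :
  (forall N, S' N -> S N) -> best_so_far S M -> best_so_far S' M.
Proof.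
move=> sub [[M3 H]|[M3 [T [sT fT tT H]]]]; [left|right]; split=> //.
  by move=> N /sub; apply: H.
by exists T; split=> // N /sub; apply: H.
Qed.

(** Only the first m cells of [vvec] encode thresholds, so vectors are compared there and not as
    functions. *)
Definition agree (N N' : nat -> nat) : Prop := forall j, j < size s -> N j = N' j.

Lemma eq_vector_value N N' : agree N N' ->
  vector_value freq s L sg N 0 0 1 = vector_value freq s L sg N' 0 0 1.
Proof.
move=> NN'; apply: eq_value => i.
by rewrite /level_width (eq_level _ NN').
Qed.

Lemma eq_vector_time N N' : agree N N' ->
  vector_time freq s sg N = vector_time freq s sg N'.
Proof. by move=> NN'; apply: eq_bigr => i _; rewrite (eq_level _ NN'). Qed.

Lemma vector_wp S M :
  0 < n -> (forall c, 0 <= freq c)%R -> valid_scheme s ->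
  perm_eq [seq sg i | i <- iota 0 n] (enum 'I_n) ->
  tables M -> best_so_far S M ->
  wp vector_prog M (vector_cost n (size s))
    (best_so_far (fun N => S N \/ agree N (nmem M vvec))).
Proof.
move=> n_gt0 freq_ge0 s_valid sg_perm tM best.
set N := nmem M vvec.
apply: wp_seq_mid (levels_wp tM) _ => M1 f1 [bM1 tmM1].
have tM1 := tables_frame f1 tM isT isT.
have {}best := best_so_far_frame f1 best isT isT.
rewrite -/N in bM1 tmM1.
apply: wp_seq_mid (table_wp tM1 bM1) _ => M2 f2 vM2.
have tM2 := tables_frame f2 tM1 isT isT.
have {}best := best_so_far_frame f2 best isT isT.
have bM2 : bounds_stored (level_width s N) M2 by move=> j j_n; rewrite f2.1 // bM1.
have tmM2 : rmem M2 rtime 0 = vector_time freq s sg N by rewrite f2.2.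
have V1 : stored_value M2 0 0 1 = vector_value freq s L sg N 0 0 1 by apply: vM2.
apply: wp_weaken (wp_if (T := 20 + (20 + (n + n).+1 * (rebuild_step_cost n))) _) _
  (fun M' _ H => H); last by rewrite /=; lia.
rewrite /=.
have -> : rmem M2 rvalue (nmem M2 vlayer 0 + nmem M2 vrow 0 + 1) = stored_value M2 0 0 1.
  by rewrite (tables_layer tM2) // (tables_row tM2).
rewrite (tables_limit tM2) V1 tmM2; case: ifP => [/andP [VL better]|/negbT bad].
  apply: wp_seq; apply: wp_step_frame => // M3 M3E f3.
  have tM3 := tables_frame f3 tM2 isT isT.
  have bM3 : bounds_stored (level_width s N) M3 by move=> j j_n; rewrite f3.1 // bM2.
  have vM3 d' i' k' : d' <= n -> i' <= n -> k' <= n ->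
      stored_value M3 d' i' k' = vector_value freq s L sg N d' i' k'.
    by move=> *; rewrite /vector_value -vM2 // /stored_value f3.2.
  have M3found : nmem M3 vfound 0 = 1 by rewrite M3E.
  have M3root : nmem M3 vroot 0 = 0 by rewrite M3E.
  have M3best : rmem M3 rbest 0 = vector_time freq s sg N by rewrite M3E /= /update.
  apply: wp_weaken (rebuild_wp n_gt0 freq_ge0 tM3 bM3 vM3 VL) (leqnn _) _.
  move=> M4 f4 [fs bfs sfs]; right.
  have [T [fsE fT tT]] := built_tree freq_ge0 s_valid sg_perm bfs VL.
  rewrite !f4.1 // !f4.2 // M3found M3root M3best; split=> //.
  exists T; split=> //.
    by move: sfs; rewrite fsE => -[].
  move=> N' [SN' VL'|/eq_vector_time -> //]; move: better.
  case: best => [[_ H]|[M2found [T' [_ _ _ H]]]]; first by case: (H N').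
  by rewrite M2found /= -ltNge => /ltW lt; apply: le_trans lt (H _ SN' VL').
apply: wp_step => //=.
case: best => [[M2found H]|[M2found [T [sT fT tT H]]]]; [left|right]; split=> //.
  move=> N' [|NN']; first exact: H.
  by rewrite (eq_vector_value NN') => VL; move: bad; rewrite VL M2found.
exists T; split=> // N' [|NN']; first exact: H.
rewrite (eq_vector_value NN') (eq_vector_time NN') => VL.
by move: bad; rewrite VL M2found /= negbK.
Qed.

(** Positions from [j] on are frozen at [N0], as they belong to the enclosing loops. *)
Definition vectors (N0 : nat -> nat) (j : nat) (N : nat -> nat) : Prop :=
  (forall j', j' < j -> N j' <= n) /\
  (forall j', j <= j' < size s -> N j' = N0 j').

Lemma enumerate_wp j S M :
  0 < n -> (forall c, 0 <= freq c)%R -> valid_scheme s ->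
  perm_eq [seq sg i | i <- iota 0 n] (enum 'I_n) ->
  tables M -> best_so_far S M ->
  wp (enumerate_prog j) M (enumerate_cost n (size s) j) (fun M' =>
    [/\ tables M', forall j', j <= j' -> nmem M' vvec j' = nmem M vvec j' &
        best_so_far (fun N => S N \/ vectors (nmem M vvec) j N) M']).
Proof.
move=> n_gt0 freq_ge0 s_valid sg_perm.
elim: j S M => [|j IH] S M tM best.
  apply: wp_weaken (vector_wp n_gt0 freq_ge0 s_valid sg_perm tM best) (leqnn _) _.
  move=> M' f best'; split; first exact: tables_frame f tM isT isT.
    by move=> j' _; rewrite f.1.
  apply: best_so_far_sub best' => N [SN|[_ NM]]; [by left|right].
  by move=> j' j's; apply: NM.
rewrite [enumerate_cost _ _ _]/= [enumerate_prog _]/=.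
pose seen v N := S N \/ vectors (nmem M vvec) j.+1 N /\ N j < v.
set loop := While _ _.
have H f v M1 : v + f = n.+1 -> tables M1 -> nmem M1 vvec j = v ->
    (forall j', j < j' -> nmem M1 vvec j' = nmem M vvec j') ->
    best_so_far (seen v) M1 ->
    wp loop M1 (f.+1 * (enumerate_cost n (size s) j + 20)) (fun M' =>
      [/\ tables M', forall j', j < j' -> nmem M' vvec j' = nmem M vvec j' &
        best_so_far (fun N => S N \/ vectors (nmem M vvec) j.+1 N) M']).
  rewrite /loop; elim: f v M1 => [|f IHf] v M1 vf tM1 M1v M1up best1.
    have nb : ~~ beval M1 (BNle (NGet vvec (NConst j)) (cell vn)).
      by rewrite /= M1v (tables_n tM1); lia.
    apply: (wp_weaken (wp_while_false (Q := eq M1) _ nb erefl)).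
      by rewrite mul1n /=; lia.
    move=> M' _ <-; split=> //.
    apply: best_so_far_sub best1 => N [SN|NM]; [by left|right]; split=> //.
    by have := NM.1 j (leqnn _); lia.
  have b : beval M1 (BNle (NGet vvec (NConst j)) (cell vn)).
    by rewrite /= M1v (tables_n tM1); lia.
  apply: wp_weaken (wp_while_true b (T1 := enumerate_cost n (size s) j + 6)
    (T2 := f.+1 * (enumerate_cost n (size s) j + 20)) _) _ (fun M' _ H => H); last first.
    by rewrite [f.+2 * _]mulSn /=; lia.
  apply: wp_seq_mid (IH _ _ tM1 best1) _ => M2 _ [tM2 M2up best2].
  have M2v : nmem M2 vvec j = v by rewrite M2up.
  apply: wp_step_frame => // M3 M3E f3.
  have tM3 := tables_frame f3 tM2 isT isT.
  have best3 := best_so_far_frame f3 best2 isT isT.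
  apply: (IHf v.+1) => //; first by lia.
  - by rewrite M3E /= /update /= eqxx M2v addn1.
  - move=> j' jj'; rewrite M3E /= /update /= gtn_eqF // M2up ?M1up //.
    exact: ltnW.
  - apply: best_so_far_sub best3 => N [SN|[NM]]; first by left; left.
    rewrite ltnS leq_eqVlt => /orP [/eqP Nv|lt]; [right|by left; right].
    split=> [j' j'j|j' /andP []]; first by apply: NM.1; apply: ltnW.
    rewrite leq_eqVlt => /orP [/eqP <- _|lt j's]; first by rewrite M1v.
    by rewrite M1up // NM.2 // lt.
apply: wp_seq; apply: wp_step_frame => // M1 M1E f1.
have tM1 := tables_frame f1 tM isT isT.
have best1 := best_so_far_frame f1 best isT isT.
apply: (H n.+1 0) => //.
- by rewrite M1E /= /update /= eqxx.
- by move=> j' jj'; rewrite M1E /= /update /= gtn_eqF.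
- by apply: best_so_far_sub best1 => N [|[]].
Qed.

(** Each character is written at its rank; injectivity of the rank prevents a later write from
    destroying an earlier one. *)
Lemma sort_wp M :
  nmem M vn 0 = n -> (forall i, rmem M rfreq i = G i) ->
  (forall i, i < n -> rank n G (sg i) = i) ->
  wp sort_prog M (for_cost (cell vn) n (5 + (for_cost (cell vn) n 60 + 10)))
    (fun M' => forall i, i < n -> nmem M' vord i = sg i).
Proof.
move=> Mn Mf rank_sg.
pose I i M1 := forall c, c < i -> nmem M1 vord (rank n G c) = c.
apply: wp_weaken (wp_for (k := n) (I := I) _ _ _ _) (leqnn _) _ => //.
- by move=> j M1 _ f; rewrite /= f.1.
- move=> i M1 i_n M1i f1 IM1.
  apply: wp_seq; apply: wp_step_frame => // M2 M2E f2.
  pose J j M3 := nmem M3 vl 0 = count (fun j' => before G j' i) (iota 0 j).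
  apply: wp_seq_mid (wp_for (k := n) (T := 60) (I := J) _ _ _ _) _ => //.
  + by move=> j M3 _ f; rewrite /= f.1 // f2.1 // f1.1.
  + by rewrite /J M2E.
  + move=> j M3 j_n M3j f3 JM3.
    have M3i : nmem M3 vi 0 = i by rewrite f3.1 // f2.1.
    have M3f x : rmem M3 rfreq x = G x by rewrite f3.2 // f2.2 // f1.2.
    apply: wp_step => //=; rewrite M3i M3j !M3f -/(before G j i) /J.
    rewrite -[j.+1]addn1 iotaD count_cat /= add0n addn0 -JM3.
    by case: ifP => _; rewrite /= /update /= ?addn0.
  + move=> M3 f3 [JM3 _ _].
    have M3i : nmem M3 vi 0 = i by rewrite f3.1 // f2.1.
    apply: wp_step => //= c; rewrite /= /update /= M3i JM3 -/(rank n G i).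
    rewrite ltnS leq_eqVlt => /orP [/eqP ->|lt]; first by rewrite eqxx.
    case: eqP => [/rank_inj ci|_].
      have cE : c = i by apply: ci => //; apply: ltn_trans i_n.
      by rewrite cE ltnn in lt.
    by rewrite f3.1 // f2.1 // IM1.
- by move=> M' _ [IM' _ _] i i_n; rewrite -{1}(rank_sg i i_n) IM'.
Qed.

Lemma multiples_wp M : nmem M vn 0 = n ->
  wp multiples_prog M (20 + (for_cost (cell vn) n 60 + for_cost (cell vn) n 60))
    (fun M' =>
      [/\ forall i, i <= n -> nmem M' vrow i = i * n.+1,
          forall d, d <= n -> nmem M' vlayer d = d * (n.+1 * n.+1) &
          forall d, d <= n -> rmem M' rnat d = (d%:R)%R]).
Proof.
move=> Mn; apply: wp_seq; apply: wp_step_frame => // M1 M1E f1.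
have M1n : nmem M1 vn 0 = n by rewrite f1.1.
pose I i M2 := (forall j, j <= i -> nmem M2 vrow j = j * n.+1) /\
               (forall j, j <= i -> rmem M2 rnat j = (j%:R)%R).
apply: wp_seq_mid (wp_for (k := n) (T := 60) (I := I) _ _ _ _) _ => //.
- by move=> j M2 _ f; rewrite /= f.1.
- by rewrite M1E; split=> j; rewrite leqn0 => /eqP ->.
- move=> i M2 i_n M2i f2 [IM2 IM2'].
  have M2n : nmem M2 vn 0 = n by rewrite f2.1.
  apply: wp_step => //=; split=> j; rewrite /= /update /= M2i ?M2n addn1 /=.
    rewrite leq_eqVlt => /orP [/eqP ->|lt]; first by rewrite eqxx IM2 // addn1 mulSn addnC.
    by rewrite ltn_eqF // IM2.
  rewrite leq_eqVlt => /orP [/eqP ->|lt]; first by rewrite eqxx IM2' // -natr1.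
  by rewrite ltn_eqF // IM2'.
move=> M2 f2 [[IM2 IM2'] _ _].
pose J i M3 := forall j, j <= i -> nmem M3 vlayer j = j * (n.+1 * n.+1).
apply: wp_weaken (wp_for (k := n) (T := 60) (I := J) _ _ _ _) (leqnn _) _ => //.
- by move=> j M3 _ f; rewrite /= f.1 // f2.1.
- by move=> j; rewrite leqn0 => /eqP -> /=; rewrite /update /= f2.1 // M1E.
- move=> i M3 i_n M3i f3 JM3.
  have M3n : nmem M3 vn 0 = n by rewrite f3.1 // f2.1.
  have M3r : nmem M3 vrow n = n * n.+1 by rewrite f3.1 // IM2.
  apply: wp_step => //= j; rewrite /= /update /= M3i M3n M3r addn1 /=.
  rewrite leq_eqVlt => /orP [/eqP ->|lt]; first by rewrite eqxx JM3 //; lia.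
  by rewrite ltn_eqF // JM3.
- move=> M3 f3 [JM3 _ _]; split=> // j j_n.
    by rewrite f3.1 // IM2.
  by rewrite f3.2 // IM2'.
Qed.

End Correctness.

Lemma dopt_wp (R : realFieldType) n (freq : 'I_n -> R) (s : scheme R) (L : R) :
  0 < n -> (forall c, 0 <= freq c)%R -> valid_scheme s ->
  wp (dopt_prog (size s)) (input_memory freq s L) (dopt_cost n (size s))
    (correct_output freq s L).
Proof.
case: n freq => // n freq _ freq_ge0 s_valid.
(* Exactly the initial contents of the frequency array, including its zeros beyond the alphabet. *)
pose G i : R := oapp freq 0%R (insub i).
have G_freq (x : 'I_n.+1) : G x = freq x by rewrite /G valK.
have [sg [sg_perm sg_anti rank_sg]] := ranking_exists G_freq.
set M0 := input_memory freq s L.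
rewrite /dopt_prog /dopt_cost.
apply: wp_seq_mid (sort_wp (M := M0) _ _ rank_sg) _ => // M1 f1 M1ord.
have M1n : nmem M1 vn 0 = n.+1 by rewrite f1.1.
apply: wp_seq_mid (multiples_wp M1n) _ => M2 f2 [M2row M2layer M2nat].
have tM2 : tables s L G sg M2.
  by split=> // *; first [by rewrite f2.1 // f1.1 | by rewrite f2.2 // f1.2
                         | by rewrite f2.1 // M1ord].
have best2 : best_so_far freq s L sg (fun=> False) M2.
  by left; split=> //; rewrite f2.1 // f1.1.
apply: wp_weaken (enumerate_wp G_freq (size s) (ltn0Sn n) freq_ge0 s_valid
  sg_perm tM2 best2) (leqnn _) _ => M3 _ [_ _ best3].
have seen T : feasible freq s L T -> exists N,
    [/\ False \/ vectors n.+1 s (nmem M2 vvec) (size s) N,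
        (vector_value freq s L sg N 0 0 1 <= L)%R &
        (vector_time freq s sg N <= decode_time freq s T)%R].
  move=> /(feasible_vector s_valid sg_perm sg_anti) [N [Nn NL Nt]].
  exists N; split=> //; right; split=> // j; lia.
case: best3 => [[M3f H]|[M3f [T [sT fT tT H]]]]; [right|left]; split=> //.
  by move=> T /seen [N [SN NL _]]; apply: H NL.
exists T; split=> //; split=> // T' /seen [N [SN NL Nt]].
by apply: le_trans tT (le_trans (H N SN NL) Nt).
Qed.

Local Open Scope ring_scope.

Theorem theorem6 (R : realFieldType) (m : nat) :
  exists (P : prog) (K : nat),
    forall (n : nat) (freq : 'I_n -> R) (s : scheme R) (L : R),
      (0 < n)%N ->
      (forall c : 'I_n, 0 <= freq c) ->
      size s = m ->
      valid_scheme s ->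
      exists (M : memory R) (t : nat),
        [/\ exec P (input_memory freq s L) M t,
            (t <= K * n ^ (3 + m))%N
          & correct_output freq s L M].
Proof.
have [c cP] := dopt_cost_bounded m.
(* The factor 2^(3 + m) turns the power of n + 1 into a power of n, as n + 1 <= 2n for positive
   n. *)
exists (dopt_prog m), (c * 2 ^ (3 + m))%N => n freq s L n_gt0 freq_ge0 sm s_valid.
have [M [t [E tT out]]] := dopt_wp L n_gt0 freq_ge0 s_valid.
rewrite sm in E tT.
exists M, t; split=> //; apply: leq_trans tT _; apply: leq_trans (cP _) _.
rewrite -mulnA leq_mul2l -expnMn leq_exp2r //; apply/orP; right; lia.
Qed.
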